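(* Let $n\ge 1$. For each $m=1,2,\ldots$ let $A^{(m)}\in\mathbb{R}^{n\times n}$, $b^{(m)}\in\mathbb{R}^n$ (linear model), $H^{(m)}\in\mathbb{R}^{q_m\times n}$ (observation matrix), $d^{(m)}\in\mathbb{R}^{q_m}$ (data), and $R^{(m)}\in\mathbb{R}^{q_m\times q_m}$ symmetric positive definite (data error covariance) be given. Let $U^{(0)}_1,U^{(0)}_2,\ldots$ be a fixed infinite sequence of i.i.d. Gaussian random vectors in $\mathbb{R}^n$, and for each $m\ge1$ let $D^{(m)}_1,D^{(m)}_2,\ldots$ be a fixed infinite sequence of i.i.d. random vectors with distribution $N(d^{(m)},R^{(m)})$, such that the sequence $(U_k^{(0)})_k$ and the sequences $(D_k^{(m)})_k$, $m\ge1$, are independent of each other. For each ensemble size $N\ge2$ let $X^{(m)}=[X^{(m)}_{1},\ldots,X^{(m)}_{N}]$ be the ensemble Kalman filter ensembles and $U^{(m)}=[U^{(m)}_{1},\ldots,U^{(m)}_{N}]$ the reference ensembles, as defined in the context (with $X^{(0)}_k=U^{(0)}_k$, $k=1,\ldots,N$). Then, for each $m\ge0$: (i) for every $N\ge 2$, the stacked random vectors $\begin{bmatrix} X^{(m)}_k \\ {U^{(m)}_k} \end{bmatrix}$, $k=1,\ldots,N$, are exchangeable; (ii) for every $1\le p<\infty$, $X^{(m)}_1\to U^{(m)}_1$ in $L^p$ as $N\to\infty$, i.e. $\lim_{N\to\infty}\left(E\left(|X^{(m)}_1-U^{(m)}_1|^p\right)\right)^{1/p}=0$.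
   Context: Random vectors $Z_1,\ldots,Z_N$ are exchangeable if for every permutation $\pi$ of $\{1,\ldots,N\}$ the joint distribution of $(Z_{\pi(1)},\ldots,Z_{\pi(N)})$ equals that of $(Z_1,\ldots,Z_N)$. $|\cdot|$ is the Euclidean norm. An ensemble is identified with the matrix whose columns are its members. Gaussian distributions may be degenerate. Ensemble Kalman filter (EnKF) ensembles, for fixed $N$: $X^{(0)}=[U^{(0)}_1,\ldots,U^{(0)}_N]$ and $X^{(0),a}=X^{(0)}$. For $m\ge1$: forecast: $X^{(m)}_k=A^{(m)}X^{(m-1),a}_k+b^{(m)}$, $k=1,\ldots,N$; analysis: $X^{(m),a}_k=X^{(m)}_k+K^{(m)}_N\left(D^{(m)}_k-H^{(m)}X^{(m)}_k\right)$, where $$K^{(m)}_N=Q^{(m)}_N (H^{(m)})^{\mathrm T}\left(H^{(m)}Q^{(m)}_N (H^{(m)})^{\mathrm T}+R^{(m)}\right)^{-1},$$ $$Q^{(m)}_N=\frac1{N-1}\sum_{k=1}^N\left(X^{(m)}_k-\overline X^{(m)}\right)\left(X^{(m)}_k-\overline X^{(m)}\right)^{\mathrm T},\qquad \overline X^{(m)}=\frac1N\sum_{k=1}^N X^{(m)}_k .$$ (The members $X_k^{(m)}$ depend on $N$ although this is suppressed in the notation.) Reference ensembles: $U^{(0),a}_k=U^{(0)}_k$ and for $m\ge1$, $U^{(m)}_k=A^{(m)}U^{(m-1),a}_k+b^{(m)}$ and $U^{(m),a}_k=U^{(m)}_k+K^{(m)}\left(D^{(m)}_k-H^{(m)}U^{(m)}_k\right)$,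 with $$K^{(m)}=Q^{(m)} (H^{(m)})^{\mathrm T}\left(H^{(m)}Q^{(m)} (H^{(m)})^{\mathrm T}+R^{(m)}\right)^{-1},$$ where $Q^{(m)}$ is the exact covariance matrix of $U^{(m)}_1$. The same perturbed data $D^{(m)}_k$ are used in both recursions. *)

(* Defs.v *)
From HB Require Import structures.
From mathcomp Require Import all_boot all_order all_algebra perm finmap.
From mathcomp Require Import all_classical all_reals all_analysis.

Set Implicit Arguments.
Unset Strict Implicit.
Unset Printing Implicit Defensive.

Import Order.TTheory GRing.Theory Num.Theory.
Import numFieldNormedType.Exports.

Local Open Scope classical_set_scope.
Local Open Scope ring_scope.

(* MathComp-Analysis has no measurable structure on matrices. As for tuples, we
   take the sigma-algebra generated by the entries; since there are finitely
   many of them this is the Borel sigma-algebra of R^(m x n). *)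
Section measurable_matrix.
Context {R : realType} (m n : nat).

Definition matrix_entry_sets : set_system 'M[R]_(m, n) :=
  \bigcup_ij preimage_set_system [set: 'M[R]_(m, n)]
    (fun M => M ij.1 ij.2) measurable.

Let matrix_set0 : <<s matrix_entry_sets >> set0.
Proof. exact: sigma_algebra0. Qed.

Let matrix_setC B : <<s matrix_entry_sets >> B -> <<s matrix_entry_sets >> (~` B).
Proof. exact: sigma_algebraC. Qed.

Let matrix_bigcup (F : (set 'M[R]_(m, n))^nat) :
  (forall i, <<s matrix_entry_sets >> (F i)) ->
  <<s matrix_entry_sets >> (\bigcup_i F i).
Proof. exact: sigma_algebra_bigcup. Qed.

HB.instance Definition _ := @isMeasurable.Build
  (sigma_display matrix_entry_sets) 'M[R]_(m, n) <<s matrix_entry_sets >>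
  matrix_set0 matrix_setC matrix_bigcup.

End measurable_matrix.

Section linear_algebra.
Context {R : realType}.

Definition enorm n (v : 'cV[R]_n) : R := Num.sqrt (\sum_i v i ord0 ^+ 2).

Definition qform n (S : 'M[R]_n) (c : 'cV[R]_n) : R :=
  (c^T *m S *m c) ord0 ord0.

Definition sym_posdef n (S : 'M[R]_n) : Prop :=
  S^T = S /\ forall c : 'cV[R]_n, c != 0 -> 0 < qform S c.

Definition sym_possemidef n (S : 'M[R]_n) : Prop :=
  S^T = S /\ forall c : 'cV[R]_n, 0 <= qform S c.

End linear_algebra.

Section probability_notions.
Context {R : realType} {d : measure_display} {T : measurableType d}.
Variable P : probability T R.

(* Equality in law is tested on measurable sets only: the value of a measure
   outside the sigma-algebra is unspecified. *)
Definition same_law d' (E : measurableType d') (X Y : T -> E) : Prop :=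
  forall B, measurable B -> P (X @^-1` B) = P (Y @^-1` B).

Definition mutually_independent (I : choiceType) (G : I -> set_system T) : Prop :=
  forall (J : {fset I}) (B : I -> set T),
    (forall i, i \in J -> G i (B i)) ->
    P (\bigcap_(i in [set` J]) B i) = (\prod_(i <- J) P (B i))%E.

Definition sigma_rv d' (E : measurableType d') (X : T -> E) : set_system T :=
  preimage_set_system setT X measurable.

Definition sigma_seq d' (E : measurableType d') (X : nat -> T -> E) :
    set_system T :=
  <<s \bigcup_k sigma_rv (X k) >>.

Definition iid d' (E : measurableType d') (X : nat -> {RV P >-> E}) : Prop :=
  mutually_independent (fun k => sigma_rv (X k)) /\
  forall j k, same_law (X j) (X k).

(* [normal_prob] takes the standard deviation, and [normal_prob mu 0] is not the
   Dirac mass at [mu]. *)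
Definition normal_law (mu v : R) : set R -> \bar R :=
  if v == 0 then \d_mu else normal_prob mu (Num.sqrt v).

(* The law N(mu, S) on R^n, S possibly singular: every linear functional c of
   the vector has law N(c^T mu, c^T S c). *)
Definition has_normal_law n (X : {RV P >-> 'cV[R]_n})
    (mu : 'cV[R]_n) (S : 'M[R]_n) : Prop :=
  sym_possemidef S /\
  forall (c : 'cV[R]_n) (B : set R), measurable B ->
    P ((fun w => (c^T *m X w) ord0 ord0) @^-1` B) =
    normal_law ((c^T *m mu) ord0 ord0) (qform S c) B.

Definition gaussian n (X : {RV P >-> 'cV[R]_n}) : Prop :=
  exists mu S, has_normal_law X mu S.

Definition cov_mx n (X : T -> 'cV[R]_n) : 'M[R]_n :=
  \matrix_(i, j) fine (covariance P (fun w => X w i ord0) (fun w => X w j ord0)).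

Definition exchangeable d' (E : measurableType d') N (Z : 'I_N -> T -> E) : Prop :=
  (forall k, measurable_fun setT (Z k)) /\
  forall s : {perm 'I_N},
    same_law (fun w => [tuple Z (s k) w | k < N]) (fun w => [tuple Z k w | k < N]).

End probability_notions.

Section filter_steps.
Context {R : realType} {T : Type} (I : Type).

Definition forecast n (A : 'M[R]_n) (b : 'cV[R]_n) (X : I -> T -> 'cV[R]_n) :
    I -> T -> 'cV[R]_n :=
  fun k w => A *m X k w + b.

Definition analysis n q (K : T -> 'M[R]_(n, q)) (H : 'M[R]_(q, n))
    (D : I -> T -> 'cV[R]_q) (X : I -> T -> 'cV[R]_n) : I -> T -> 'cV[R]_n :=
  fun k w => X k w + K w *m (D k w - H *m X k w).

End filter_steps.

Section kalman.
Context {R : realType}.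

Definition gain n q (Q : 'M[R]_n) (H : 'M[R]_(q, n)) (V : 'M[R]_q) :
    'M[R]_(n, q) :=
  Q *m H^T *m invmx (H *m Q *m H^T + V).

Definition sample_mean n N (x : 'I_N -> 'cV[R]_n) : 'cV[R]_n :=
  N%:R^-1 *: \sum_k x k.

Definition sample_cov n N (x : 'I_N -> 'cV[R]_n) : 'M[R]_n :=
  (N%:R - 1)^-1 *: \sum_k (x k - sample_mean x) *m (x k - sample_mean x)^T.

Context {d : measure_display} {T : measurableType d}.
Variables (P : probability T R) (n : nat) (q : nat -> nat).
Variables (A : nat -> 'M[R]_n) (b : nat -> 'cV[R]_n).
Variables (H : forall m, 'M[R]_(q m, n)) (V : forall m, 'M[R]_(q m)).
Variables (U0 : nat -> T -> 'cV[R]_n) (D : forall m, nat -> T -> 'cV[R]_(q m)).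

(* Members are numbered from 0, and time 0 is the initial ensemble: the values
   at time 0 of A, b, H, V and D are never used. *)

Fixpoint enkf_analysis N (m : nat) : 'I_N -> T -> 'cV[R]_n :=
  if m is m'.+1 then
    let X := forecast (A m) (b m) (enkf_analysis m') in
    let QN w := sample_cov (X^~ w) in
    analysis (fun w => gain (QN w) (H m) (V m)) (H m) (fun k : 'I_N => D m k) X
  else fun k => U0 k.

Definition enkf N (m : nat) : 'I_N -> T -> 'cV[R]_n :=
  if m is m'.+1 then forecast (A m) (b m) (enkf_analysis m')
  else fun k => U0 k.

Fixpoint reference_analysis (m : nat) : nat -> T -> 'cV[R]_n :=
  if m is m'.+1 then
    let U := forecast (A m) (b m) (reference_analysis m') in
    analysis (fun=> gain (cov_mx P (U 0%N)) (H m) (V m)) (H m) (D m) U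
  else U0.

Definition reference (m : nat) : nat -> T -> 'cV[R]_n :=
  if m is m'.+1 then forecast (A m) (b m) (reference_analysis m') else U0.

End kalman.

Arguments enkf_analysis {R d T n q} A b H V U0 D N m.
Arguments enkf {R d T n q} A b H V U0 D N m.

(* Main.v *)
Require Import Defs.
From HB Require Import structures.
From mathcomp Require Import all_boot all_order all_algebra perm finmap ring lra.
From mathcomp Require Import all_classical all_reals all_analysis measurable_realfun.

Set Implicit Arguments.
Unset Strict Implicit.
Unset Printing Implicit Defensive.

Import Order.TTheory GRing.Theory Num.Theory.
Import numFieldNormedType.Exports.

Local Open Scope classical_set_scope.
Local Open Scope ring_scope.

(* Exchangeability: the initial vectors and the data form one random element of
   a path space, whose law is determined by finite-dimensional boxes and is
   therefore invariant under permutation of the members. Both recursions commute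
   with such permutations.

   Convergence, by induction on time: all estimates are for moments of every
   order, uniformly over the members. The map from the covariance Q to the gain
   is globally Lipschitz, with constants depending on Q^(m) and V only, because
   H Q H^T + V >= V bounds the inverse in the Loewner order. Hence
     X^a - U^a = (X - U) - K_N H (X - U) + (K_N - K) (D - H U)
   tends to 0 as soon as the sample covariance Q_N of X tends to Q^(m). Its
   difference with the sample covariance of U is small by bilinearity; that of U
   converges by the law of large numbers, since the reference members are
   independent (expressed by splicing two independent copies of the path). *)

(** * Measurability of matrix operations and of the filters *)

(** Moments of all orders are carried together because the analysis step multiplies random factors
    none of which is bounded: the gain by the forecast error, and the gain error by the innovation.
    Such a product is controlled by moments of twice the order, so an induction at one fixed order
    would not close. The members of the filter are coupled through their sample covariance, which
    blocks a direct law of large numbers; the reference members provide the independent comparison.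
    Uniformity over the members is what lets errors pass to averages, by convexity. The reference
    recursion mentions [P] through its gains, so these are frozen as constants before it is read as
    a function of the path. *)

Section measurable_matrix_operations.
Context {R : realType} {d : measure_display} {T : measurableType d}.

Lemma measurable_mxP m n (f : T -> 'M[R]_(m, n)) :
  measurable_fun setT f <->
  forall i j, measurable_fun setT (fun w => f w i j).
Proof.
split=> [mf i j|mf].
  have me : measurable_fun setT (fun M : 'M[R]_(m, n) => M i j).
    move=> _ B mB; apply: sub_sigma_algebra; exists (i, j) => //.
    by exists B.
  exact: (measurableT_comp me mf).
apply: (measurability (@matrix_entry_sets R m n)) => //.
move=> _ [_ [[i j] _ [B mB <-]] <-].
by rewrite setTI setTI; have := mf i j measurableT B mB; rewrite setTI.
Qed.

Lemma measurable_mx_entry m n (f : T -> 'M[R]_(m, n)) i j :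
  measurable_fun setT f -> measurable_fun setT (fun w => f w i j).
Proof. by move/measurable_mxP. Qed.

Lemma measurable_addmx m n (f g : T -> 'M[R]_(m, n)) :
  measurable_fun setT f -> measurable_fun setT g ->
  measurable_fun setT (fun w => f w + g w).
Proof.
move=> mf mg; apply/measurable_mxP => i j.
under eq_fun do rewrite mxE.
by apply: measurable_funD; exact: measurable_mx_entry.
Qed.

Lemma measurable_oppmx m n (f : T -> 'M[R]_(m, n)) :
  measurable_fun setT f -> measurable_fun setT (fun w => - f w).
Proof.
move=> mf; apply/measurable_mxP => i j.
under eq_fun do rewrite mxE.
by apply: measurable_funN; exact: measurable_mx_entry.
Qed.

Lemma measurable_scalemx m n (c : R) (f : T -> 'M[R]_(m, n)) :
  measurable_fun setT f -> measurable_fun setT (fun w => c *: f w).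
Proof.
move=> mf; apply/measurable_mxP => i j.
under eq_fun do rewrite mxE.
by apply: measurable_funM => //; exact: measurable_mx_entry.
Qed.

Lemma measurable_trmx m n (f : T -> 'M[R]_(m, n)) :
  measurable_fun setT f -> measurable_fun setT (fun w => (f w)^T).
Proof.
move=> mf; apply/measurable_mxP => i j.
by under eq_fun do rewrite mxE; exact: measurable_mx_entry.
Qed.

Lemma measurable_mulmx m n p (f : T -> 'M[R]_(m, n)) (g : T -> 'M[R]_(n, p)) :
  measurable_fun setT f -> measurable_fun setT g ->
  measurable_fun setT (fun w => f w *m g w).
Proof.
move=> mf mg; apply/measurable_mxP => i j.
under eq_fun do rewrite mxE.
apply: measurable_sum => k.
by apply: measurable_funM; exact: measurable_mx_entry.
Qed.

Lemma measurable_sum_mx m n (I : Type) (s : seq I) (f : I -> T -> 'M[R]_(m, n)) :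
  (forall k, measurable_fun setT (f k)) ->
  measurable_fun setT (fun w => \sum_(k <- s) f k w).
Proof.
move=> mf; apply/measurable_mxP => i j.
under eq_fun do rewrite summxE.
by apply: measurable_sum => k; exact: measurable_mx_entry.
Qed.

Lemma measurable_col_mx m1 m2 n (f : T -> 'M[R]_(m1, n)) (g : T -> 'M[R]_(m2, n)) :
  measurable_fun setT f -> measurable_fun setT g ->
  measurable_fun setT (fun w => col_mx (f w) (g w)).
Proof.
move=> mf mg; apply/measurable_mxP => i j.
under eq_fun do rewrite mxE.
by case: (fintype.split i) => k; exact: measurable_mx_entry.
Qed.

Lemma measurable_invr (f : T -> R) :
  measurable_fun setT f -> measurable_fun setT (fun w => (f w)^-1).
Proof.
move=> mf.
(* [x^-1 = x * (x^2)^-1] also holds at 0, where both sides are 0, and the second factor is a real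
   power of a nonnegative number. *)
rewrite (_ : (fun _ => _) = (fun w => f w * powR (f w ^+ 2) (-1))).
  apply: measurable_funM => //.
  apply: (measurableT_comp (measurable_powR (-1))).
  exact: measurable_funX.
apply/funext => w; rewrite powR_inv1 ?sqr_ge0//.
have [->|f0] := eqVneq (f w) 0; first by rewrite mul0r invr0.
by rewrite expr2 invfM mulrA divff// mul1r.
Qed.

Lemma measurable_det n (f : T -> 'M[R]_n) :
  measurable_fun setT f -> measurable_fun setT (fun w => \det (f w)).
Proof.
move=> mf; apply: measurable_sum => s.
apply: measurable_funM => //.
by apply: measurable_prod => i _; exact: measurable_mx_entry.
Qed.

(** [invmx] is defined by cases: Cramer's formula on invertible matrices, the matrix itself
    otherwise. Both branches are measurable, and so is the test, which compares the determinant with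
    0. *)
Lemma measurable_invmx n (f : T -> 'M[R]_n) :
  measurable_fun setT f -> measurable_fun setT (fun w => invmx (f w)).
Proof.
move=> mf.
have madj : measurable_fun setT (fun w => \adj (f w)).
  apply/measurable_mxP => i j; under eq_fun do rewrite mxE.
  apply: measurable_funM => //; apply: measurable_det.
  apply/measurable_mxP => k l; under eq_fun do rewrite !mxE.
  exact: measurable_mx_entry.
have mdet := measurable_det mf.
have munit : measurable_fun setT (fun w => f w \in unitmx).
  under eq_fun do rewrite unitmxE unitfE.
  apply: measurable_neg; exact: measurable_fun_eqr.
apply: measurable_fun_ifT => //.
apply/measurable_mxP => i j; under eq_fun do rewrite mxE.
by apply: measurable_funM; [exact: measurable_invr|exact: measurable_mx_entry].
Qed.

End measurable_matrix_operations.

Section filter_measurability.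
Context {R : realType} {d : measure_display} {T : measurableType d}.
Variables (n : nat) (q : nat -> nat).
Variables (A : nat -> 'M[R]_n) (b : nat -> 'cV[R]_n).
Variables (H : forall m, 'M[R]_(q m, n)) (V : forall m, 'M[R]_(q m)).

Lemma measurable_forecast (I : Type) (M : 'M[R]_n) (c : 'cV[R]_n)
    (X : I -> T -> 'cV[R]_n) :
  (forall k, measurable_fun setT (X k)) ->
  forall k, measurable_fun setT (forecast M c X k).
Proof.
by move=> mX k; apply: measurable_addmx => //; exact: measurable_mulmx.
Qed.

Lemma measurable_analysis (I : Type) p (K : T -> 'M[R]_(n, p)) (M : 'M[R]_(p, n))
    (Z : I -> T -> 'cV[R]_p) (X : I -> T -> 'cV[R]_n) :
  measurable_fun setT K ->
  (forall k, measurable_fun setT (Z k)) ->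
  (forall k, measurable_fun setT (X k)) ->
  forall k, measurable_fun setT (analysis K M Z X k).
Proof.
move=> mK mZ mX k; apply: measurable_addmx => //.
apply: measurable_mulmx => //; apply: measurable_addmx => //.
by apply: measurable_oppmx; exact: measurable_mulmx.
Qed.

Lemma measurable_gain p (Q : T -> 'M[R]_n) (M : 'M[R]_(p, n)) (W : 'M[R]_p) :
  measurable_fun setT Q -> measurable_fun setT (fun w => gain (Q w) M W).
Proof.
move=> mQ; apply: measurable_mulmx; first exact: measurable_mulmx.
apply: measurable_invmx; apply: measurable_addmx => //.
by apply: measurable_mulmx => //; exact: measurable_mulmx.
Qed.

Lemma measurable_sample_cov N (X : 'I_N -> T -> 'cV[R]_n) :
  (forall k, measurable_fun setT (X k)) ->
  measurable_fun setT (fun w => sample_cov (X^~ w)).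
Proof.
move=> mX.
have mc k : measurable_fun setT (fun w => X k w - sample_mean (X^~ w)).
  apply: measurable_addmx => //; apply: measurable_oppmx.
  by apply: measurable_scalemx; exact: measurable_sum_mx.
apply: measurable_scalemx; apply: measurable_sum_mx => k.
by apply: measurable_mulmx => //; exact: measurable_trmx.
Qed.

Variables (U0 : nat -> T -> 'cV[R]_n) (D : forall m, nat -> T -> 'cV[R]_(q m)).
Hypothesis mU0 : forall k, measurable_fun setT (U0 k).
Hypothesis mD : forall m k, measurable_fun setT (D m.+1 k).

Lemma measurable_enkf_analysis N m (k : 'I_N) :
  measurable_fun setT (enkf_analysis A b H V U0 D N m k).
Proof.
elim: m k => [k|m IH]; first exact: mU0.
apply: measurable_analysis => //; last exact: measurable_forecast.
apply: measurable_gain; apply: measurable_sample_cov.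
exact: measurable_forecast.
Qed.

Lemma measurable_enkf N m (k : 'I_N) :
  measurable_fun setT (enkf A b H V U0 D N m k).
Proof.
case: m => [|m]; first exact: mU0.
by apply: measurable_forecast => j; exact: measurable_enkf_analysis.
Qed.

End filter_measurability.

(** * Path space and the law of the driving sequences *)

Section path_space.
Context {R : realType} (p : nat -> nat).

(* An element [x] records a realisation of all the driving vectors: [x j k] is
   the k-th member of the j-th sequence. *)
Definition path : Type := forall j : nat, nat -> 'cV[R]_(p j).

HB.instance Definition _ := gen_eqMixin path.
HB.instance Definition _ := gen_choiceMixin path.
HB.instance Definition _ := isPointed.Build path (fun _ _ => 0).

Definition box (B : forall j, nat -> set 'cV[R]_(p j)) : set path :=
  [set x | forall j k, B j k (x j k)].

(** Only indices inside the square of side [M] are constrained. One bound for both indices makes the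
    probability of a box a finite double product. *)
Definition measurable_block (M : nat) (B : forall j, nat -> set 'cV[R]_(p j)) :=
  (forall j k, measurable (B j k)) /\
  (forall j k, (M <= maxn j k)%N -> B j k = setT).

Definition boxes : set_system path :=
  [set box B | B in [set B | exists M, measurable_block M B]].

Let path_set0 : <<s boxes >> set0.
Proof. exact: sigma_algebra0. Qed.

Let path_setC B : <<s boxes >> B -> <<s boxes >> (~` B).
Proof. exact: sigma_algebraC. Qed.

Let path_bigcup (F : (set path)^nat) :
  (forall i, <<s boxes >> (F i)) -> <<s boxes >> (\bigcup_i F i).
Proof. exact: sigma_algebra_bigcup. Qed.

HB.instance Definition _ := @isMeasurable.Build
  (sigma_display boxes) path <<s boxes >> path_set0 path_setC path_bigcup.

Lemma boxT : box (fun _ _ => setT) = setT.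
Proof. by apply/seteqP; split. Qed.

Lemma setI_closed_boxes : setI_closed boxes.
Proof.
move=> _ _ [B [M [mB BT]] <-] [C [N [mC CT]] <-].
exists (fun j k => B j k `&` C j k).
  exists (maxn M N); split => [j k|j k]; first exact: measurableI.
  by rewrite geq_max => /andP[Mjk Njk]; rewrite BT// CT// setIT.
apply/seteqP; split => [x BC|x [Bx Cx] j k]; last by split.
by split => j k; have [] := BC j k.
Qed.

Lemma measurable_coord j k : measurable_fun setT (fun x : path => x j k).
Proof.
move=> _ B mB; apply: sub_sigma_algebra.
(* The side of the box has a type depending on [j'], so [B] is reached by transport along a proof of
   [j' = j]; at every other index the condition is vacuous. *)
exists (fun j' k' => [set v | forall e : j' = j, k' = k -> B (ecast i 'cV[R]_(p i) e v)]).
  exists (maxn j k).+1; split => [j' k'|j' k' jk].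
    have [e|nj] := pselect (j' = j); last first.
      rewrite (_ : mkset _ = setT); first exact: measurableT.
      by apply/seteqP; split => // v _ e; exfalso; exact: nj.
    subst j'; have [->|nk] := eqVneq k' k.
      rewrite (_ : mkset _ = B) //; apply/seteqP; split => [v /(_ erefl erefl)//|v Bv e _].
      by rewrite (Prop_irrelevance e erefl).
    rewrite (_ : mkset _ = setT); first exact: measurableT.
    by apply/seteqP; split => // v _ e0 e; exfalso; move: nk; rewrite e eqxx.
  apply/seteqP; split => // v _ e ek; exfalso; move: jk; subst j' k'.
  by rewrite ltnn.
rewrite setTI; apply/seteqP; split => [x /(_ j k erefl erefl)//|x Bx j' k' e ek].
by subst j' k'.
Qed.

Lemma measurable_path d (T : measurableType d) (f : T -> path) :
  (forall j k, measurable_fun setT (fun w => f w j k)) -> measurable_fun setT f.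
Proof.
move=> mf; apply: (measurability boxes) => //.
move=> _ [_ [B [M [mB _]] <-] <-].
rewrite setTI (_ : _ @^-1` _ =
    \bigcap_j \bigcap_k ((fun w => f w j k) @^-1` B j k)).
  apply: bigcapT_measurable => j; apply: bigcapT_measurable => k.
  by rewrite -[X in measurable X]setTI; exact: mf.
by apply/seteqP; split => [w fw j _ k _|w fw j k]; [exact: fw|exact: fw].
Qed.

Section equality_in_law.
Context d1 d2 (T1 : measurableType d1) (T2 : measurableType d2).
Variables (P1 : probability T1 R) (P2 : probability T2 R).
Variables (f1 : T1 -> path) (f2 : T2 -> path).
Hypotheses (mf1 : measurable_fun setT f1) (mf2 : measurable_fun setT f2).
Hypothesis eq_boxes : forall M B, measurable_block M B ->
  P1 (f1 @^-1` box B) = P2 (f2 @^-1` box B).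

Let F1 : {mfun T1 >-> path} := HB.pack f1 (isMeasurableFun.Build _ _ _ _ _ mf1).
Let F2 : {mfun T2 >-> path} := HB.pack f2 (isMeasurableFun.Build _ _ _ _ _ mf2).

(** The boxes form a generating class closed under intersection, so two probability laws that agree
    on them coincide. The two sample spaces are distinct variables because [T] is later compared
    with [T * T]. *)
Lemma path_law_unique (E : set path) : measurable E ->
  P1 (f1 @^-1` E) = P2 (f2 @^-1` E).
Proof.
apply: (@measure_unique _ _ _ boxes (fun=> setT) _ _ _ _
  (distribution P1 F1) (distribution P2 F2)) => //.
- exact: setI_closed_boxes.
- move=> _; exists (fun _ _ => setT); last exact: boxT.
  by exists 0%N; split.
- exact: bigcup_const.
- by move=> _ [B [M MB] <-]; exact: eq_boxes MB.
- move=> _; rewrite (le_lt_trans (probability_le1 (distribution P1 F1) _))//.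
  by rewrite ltry.
Qed.

(** For nonnegative functions both sides are integrals against the common law. The signed case takes
    the difference of the positive and negative parts. *)
Lemma integral_path_law (g : path -> \bar R) : measurable_fun setT g ->
  (\int[P1]_w g (f1 w) = \int[P2]_w g (f2 w))%E.
Proof.
move=> mg.
have ge0_case (h : path -> \bar R) : measurable_fun setT h ->
    (forall x, 0 <= h x)%E -> (\int[P1]_w h (f1 w) = \int[P2]_w h (f2 w))%E.
  move=> mh h0.
  have := @ge0_integral_distribution _ _ _ _ _ P1 F1 h mh h0.
  have := @ge0_integral_distribution _ _ _ _ _ P2 F2 h mh h0.
  rewrite /comp /= => <- <-; apply: eq_measure_integral => E mE _.
  exact: path_law_unique.
rewrite -[LHS]/(\int[P1]_w (g \o f1) w)%E -[RHS]/(\int[P2]_w (g \o f2) w)%E.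
rewrite integralE [RHS]integralE (funepos_comp g f1) (funepos_comp g f2).
rewrite (funeneg_comp g f1) (funeneg_comp g f2).
congr (_ - _)%E.
- apply: (ge0_case (g^\+)%E) => [|x]; first exact: measurable_funepos.
  exact: funepos_ge0.
- apply: (ge0_case (g^\-)%E) => [|x]; first exact: measurable_funeneg.
  exact: funeneg_ge0.
Qed.

End equality_in_law.
End path_space.

Arguments path R p : clear implicits.

(** * Symmetries and splitting of the driving path *)

Section independent_sequences.
Context {R : realType} {d : measure_display} {T : measurableType d}.
Variable P : probability T R.

(** Independence is defined over finite sets of indices. The values of [s] below [M] form such a set
    without repetition, thanks to the left inverse [s'], which also recovers the event attached to
    each index. *)
Lemma mutually_independent_nat (G : nat -> set_system T) (s s' : nat -> nat)
    (E : nat -> set T) M :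
  mutually_independent P G -> cancel s s' ->
  (forall k, (k < M)%N -> G (s k) (E k)) ->
  P (\bigcap_(k in `I_M) E k) = (\prod_(k < M) P (E k))%E.
Proof.
move=> indG ss' GE.
have us : uniq (map s (iota 0 M)) by rewrite map_inj_uniq ?iota_uniq//; exact: can_inj ss'.
have := indG (seq_fset tt (map s (iota 0 M))) (E \o s').
rewrite (_ : \bigcap_(i in _) _ = \bigcap_(k in `I_M) E k).
  move=> ->; first rewrite (perm_big (map s (iota 0 M))) /=.
  - rewrite big_map -(big_mkord predT (fun k => P (E k))) /index_iota subn0.
    by apply: eq_bigr => k _; rewrite /= ss'.
  - by have := seq_fset_perm tt (map s (iota 0 M)); rewrite undup_id.
  move=> i; rewrite seq_fsetE => /mapP[k]; rewrite mem_iota add0n => /= kM ->.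
  by rewrite ss'; exact: GE.
apply/seteqP; split => [w Ew k kM|w Ew i].
  have := Ew (s k); rewrite /= ss'; apply.
  have : s k \in seq_fset tt (map s (iota 0 M)) by rewrite seq_fsetE map_f// mem_iota.
  by [].
suff: i \in seq_fset tt (map s (iota 0 M)) -> E (s' i) w by [].
rewrite seq_fsetE => /mapP[k]; rewrite mem_iota add0n => /= kM ->.
by rewrite ss'; exact: Ew.
Qed.

Variable (p : nat -> nat) (X : forall j, nat -> {RV P >-> 'cV[R]_(p j)}).

Definition driving_path (w : T) : path R p := fun j k => X j k w.

Lemma measurable_driving_path : measurable_fun setT driving_path.
Proof. by apply: measurable_path => j k; exact: measurable_funPT. Qed.

Hypothesis iidX : forall j, iid (X j).
Hypothesis indX : mutually_independent P (fun j => sigma_seq (X j)).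

(** The right-hand side does not involve [s], which is the source of all invariance below.
    Independence between the sequences, then inside each, factorises the box; identical distribution
    sends every factor to member 0. *)
Lemma prob_box (s s' : nat -> nat) M (B : forall j, nat -> set 'cV[R]_(p j)) :
  cancel s s' -> measurable_block M B ->
  P [set w | forall j k, B j k (X j (s k) w)] =
  (\prod_(j < M) \prod_(k < M) P (X j 0%N @^-1` B j k))%E.
Proof.
move=> ss' [mB BT].
pose E j := \bigcap_(k in `I_M) (X j (s k) @^-1` B j k).
rewrite (_ : mkset _ = \bigcap_(j in `I_M) E j).
  rewrite (@mutually_independent_nat _ id id E M indX)//.
    apply: eq_bigr => j _; have [indXj lawXj] := iidX j.
    rewrite (mutually_independent_nat indXj ss').
      by apply: eq_bigr => k _; exact: lawXj.
    by move=> k _; exists (B j k) => //; rewrite setTI.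
  move=> j _; apply: (@fin_bigcap_measurable _ (g_sigma_algebraType
    (\bigcup_k sigma_rv (X j k)))) => // k _.
  apply: sub_sigma_algebra; exists (s k) => //.
  by exists (B j k) => //; rewrite setTI.
apply/seteqP; split => [w Bw j _ k _|w Ew j k]; first exact: Bw.
have [jM|Mj] := ltnP j M; last by rewrite BT// leq_max Mj.
have [kM|Mk] := ltnP k M; last by rewrite BT// leq_max Mk orbT.
exact: Ew.
Qed.

Lemma driving_path_shuffle (s s' : nat -> nat) (E : set (path R p)) :
  cancel s s' -> measurable E ->
  P (driving_path @^-1` E) = P ((fun w j k => X j (s k) w) @^-1` E).
Proof.
move=> ss'; apply: path_law_unique; first exact: measurable_driving_path.
  by apply: measurable_path => j k; exact: measurable_funPT.
move=> M B MB; rewrite (prob_box ss' MB).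
exact: (@prob_box id id).
Qed.

Definition splice (k0 : nat) (x y : path R p) : path R p :=
  fun j k => if k == k0 then x j k else y j k.

Definition driving_splice k0 (z : T * T) : path R p :=
  splice k0 (driving_path z.1) (driving_path z.2).

Lemma measurable_driving_splice k0 : measurable_fun setT (driving_splice k0).
Proof.
apply: measurable_path => j k; rewrite /driving_splice /splice.
by case: (k == k0); apply: measurableT_comp => //; exact: measurable_funPT.
Qed.

(** A box is cut into a condition [B1] on member [k0] and a condition [B2] on the other members. In
    the product formula each factor is trivial for one of the two, so the two probabilities multiply
    to that of the box. *)
Lemma driving_path_splice k0 M (B : forall j, nat -> set 'cV[R]_(p j)) :
  measurable_block M B ->
  P (driving_path @^-1` box B) = (P \x P)%E (driving_splice k0 @^-1` box B).
Proof.
move=> MB; have [mB BT] := MB.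
pose B1 j k := if k == k0 then B j k else setT.
pose B2 j k := if k == k0 then setT else B j k.
have MB1 : measurable_block M B1.
  by split=> j k; rewrite /B1; case: ifP => // _; exact: BT.
have MB2 : measurable_block M B2.
  by split=> j k; rewrite /B2; case: ifP => // _; exact: BT.
have mbox C : measurable_block M C -> measurable (driving_path @^-1` box C).
  move=> MC; rewrite -[X in measurable X]setTI; apply: measurable_driving_path => //.
  by apply: sub_sigma_algebra; exists C => //; exists M.
have Ebox C (MC : measurable_block M C) : P (driving_path @^-1` box C) =
    (\prod_(j < M) \prod_(k < M) P (X j 0%N @^-1` C j k))%E.
  exact: (@prob_box id id).
rewrite (_ : driving_splice k0 @^-1` box B =
    (driving_path @^-1` box B1) `*` (driving_path @^-1` box B2)).
  transitivity (P (driving_path @^-1` box B1) * P (driving_path @^-1` box B2))%E;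
    last by rewrite product_measure1E//; exact: mbox.
  rewrite (Ebox _ MB) (Ebox _ MB1) (Ebox _ MB2) -big_split/=; apply: eq_bigr => j _.
  rewrite -big_split/=; apply: eq_bigr => k _.
  rewrite /B1 /B2; case: ifP => _; rewrite preimage_setT probability_setT.
    by rewrite mule1.
  by rewrite mul1e.
apply/seteqP; split => [[w w'] Bw|[w w'] [/= Bw Bw'] j k]; first split => j k /=.
- have := Bw j k; rewrite /driving_splice /splice /B1 /driving_path.
  by case: ifP.
- have := Bw j k; rewrite /driving_splice /splice /B2 /driving_path.
  by case: ifP.
- have := Bw j k; have := Bw' j k.
  by rewrite /driving_splice /splice /B1 /B2 /driving_path; case: ifP.
Qed.

(** The last two hypotheses say that [f] reads member [k0] only and [g] the others only. Replacing
    the path by a splice of independent copies separates the variables, and Fubini's theorem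
    factorises the integral. *)
Lemma driving_path_uncorrelated k0 (f g : path R p -> R) :
  measurable_fun setT f -> measurable_fun setT g ->
  P.-integrable setT (EFin \o f \o driving_path) ->
  P.-integrable setT (EFin \o g \o driving_path) ->
  (forall x y, f (splice k0 x y) = f x) ->
  (forall x y, g (splice k0 x y) = g y) ->
  (\int[P]_w (f (driving_path w) * g (driving_path w))%:E =
   (\int[P]_w (f (driving_path w))%:E) * \int[P]_w (g (driving_path w))%:E)%E.
Proof.
move=> mf mg intf intg fE gE.
rewrite (integral_path_law (P2 := (P \x P)%E) measurable_driving_path
  (measurable_driving_splice k0) (driving_path_splice k0)
  (g := EFin \o (f \* g)))/=; last first.
  by apply/measurable_EFinP; exact: measurable_funM.
under eq_integral do rewrite fE gE.
pose F (z : T * T) := (f (driving_path z.1) * g (driving_path z.2))%:E.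
have mf' : measurable_fun setT (f \o driving_path).
  exact: measurableT_comp measurable_driving_path.
have mg' : measurable_fun setT (g \o driving_path).
  exact: measurableT_comp measurable_driving_path.
have mF : measurable_fun setT F.
  apply/measurable_EFinP; apply: measurable_funM.
    exact: (measurableT_comp mf' measurable_fst).
  exact: (measurableT_comp mg' measurable_snd).
have intF : (P \x P)%E.-integrable setT F.
  apply/integrable12ltyP => //=.
  under eq_integral => x _.
    under eq_integral => y _ do rewrite /F /= normrM EFinM.
    rewrite ge0_integralZl//; last first.
      apply/measurable_EFinP; exact: measurableT_comp.
    over.
  rewrite ge0_integralZr//; first last.
  - by apply: integral_ge0.
  - by apply/measurable_EFinP; exact: measurableT_comp.
  have [_ If] := integrableP _ _ _ intf; have [_ Ig] := integrableP _ _ _ intg.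
  apply: lte_mul_pinfty; [exact: integral_ge0| |exact: Ig || exact: If].
  by rewrite ge0_fin_numE; [exact: If || exact: Ig|exact: integral_ge0].
transitivity (\int[(P \x P)%E]_z F z)%E; first by [].
rewrite -integral12_prod_meas1// /fubini_F /F /=.
under eq_integral => x _.
  under eq_integral => y _ do rewrite EFinM.
  rewrite integralZl//.
  over.
have /fineK <- : (\int[P]_w (g (driving_path w))%:E)%E \is a fin_num.
  exact: integrable_fin_num.
by rewrite integralZr.
Qed.

End independent_sequences.

(** * Exchangeability *)

Section filters_on_paths.
Context {R : realType} (n : nat) (q : nat -> nat).
Variables (A : nat -> 'M[R]_n) (b : nat -> 'cV[R]_n).
Variables (H : forall m, 'M[R]_(q m, n)) (V : forall m, 'M[R]_(q m)).

(** The reference recursion with its gains as a parameter. It no longer refers to a probability, so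
    it can be evaluated on paths with the gains computed on [T]. *)
Fixpoint gained_analysis (T : Type) (K : forall m, 'M[R]_(n, q m))
    (U0 : nat -> T -> 'cV[R]_n) (D : forall m, nat -> T -> 'cV[R]_(q m))
    (m : nat) : nat -> T -> 'cV[R]_n :=
  if m is m'.+1 then
    analysis (fun=> K m) (H m) (D m)
      (forecast (A m) (b m) (gained_analysis K U0 D m'))
  else U0.

Definition gained (T : Type) (K : forall m, 'M[R]_(n, q m))
    (U0 : nat -> T -> 'cV[R]_n) (D : forall m, nat -> T -> 'cV[R]_(q m))
    (m : nat) : nat -> T -> 'cV[R]_n :=
  if m is m'.+1 then forecast (A m) (b m) (gained_analysis K U0 D m') else U0.

Definition reference_gain {d} {T : measurableType d} (P : probability T R)
    (U0 : nat -> T -> 'cV[R]_n) (D : forall m, nat -> T -> 'cV[R]_(q m)) m :=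
  gain (cov_mx P (reference P A b H V U0 D m 0%N)) (H m) (V m).

Lemma reference_gained d (T : measurableType d) (P : probability T R)
    (U0 : nat -> T -> 'cV[R]_n) (D : forall m, nat -> T -> 'cV[R]_(q m)) m :
  reference P A b H V U0 D m = gained (reference_gain P U0 D) U0 D m.
Proof.
case: m => [//|m] /=; congr forecast.
elim: m => [//|m IH] /=; rewrite -IH.
by [].
Qed.

Lemma measurable_gained d (T : measurableType d) (K : forall m, 'M[R]_(n, q m))
    (U0 : nat -> T -> 'cV[R]_n) (D : forall m, nat -> T -> 'cV[R]_(q m)) m k :
  (forall k, measurable_fun setT (U0 k)) ->
  (forall m k, measurable_fun setT (D m.+1 k)) ->
  measurable_fun setT (gained K U0 D m k).
Proof.
move=> mU mD; case: m => [|m]; first exact: mU.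
apply: measurable_forecast; elim: m {k} => [|m IH] k; first exact: mU.
by apply: measurable_analysis => //; exact: measurable_forecast.
Qed.

(** With deterministic gains the members do not interact: each is a function of the driving vectors
    carrying its own index. Allowing two sample spaces covers both the passage to paths and changes
    of index. *)
Lemma gained_transport (T T' : Type) (K : forall m, 'M[R]_(n, q m))
    (U0 : nat -> T -> 'cV[R]_n) (D : forall m, nat -> T -> 'cV[R]_(q m))
    (U0' : nat -> T' -> 'cV[R]_n) (D' : forall m, nat -> T' -> 'cV[R]_(q m))
    (w : T) (w' : T') (k k' : nat) m :
  U0' k' w' = U0 k w -> (forall m, D' m.+1 k' w' = D m.+1 k w) ->
  gained K U0' D' m k' w' = gained K U0 D m k w.
Proof.
move=> eU eD; case: m => [//|m]; rewrite /= /forecast.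
suff -> : gained_analysis K U0' D' m k' w' = gained_analysis K U0 D m k w by [].
by elim: m => [//|m IH]; rewrite /= /analysis /forecast IH eD.
Qed.

Lemma sample_cov_perm N (x : 'I_N -> 'cV[R]_n) (s : {perm 'I_N}) :
  sample_cov (fun k => x (s k)) = sample_cov x.
Proof.
have em : sample_mean (fun k => x (s k)) = sample_mean x.
  by rewrite /sample_mean [in RHS](reindex_inj (@perm_inj _ s)).
by rewrite /sample_cov em [in RHS](reindex_inj (@perm_inj _ s)).
Qed.

(** The members interact only through the sample covariance, a symmetric function of the ensemble,
    so the recursion is equivariant. *)
Lemma enkf_transport d (T : measurableType d) d' (T' : measurableType d')
    (U0 : nat -> T -> 'cV[R]_n) (D : forall m, nat -> T -> 'cV[R]_(q m))
    (U0' : nat -> T' -> 'cV[R]_n) (D' : forall m, nat -> T' -> 'cV[R]_(q m))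
    N (s : {perm 'I_N}) (w : T) (w' : T') m (k : 'I_N) :
  (forall k : 'I_N, U0' k w' = U0 (s k) w) ->
  (forall m (k : 'I_N), D' m.+1 k w' = D m.+1 (s k) w) ->
  enkf A b H V U0' D' N m k w' = enkf A b H V U0 D N m (s k) w.
Proof.
move=> eU eD.
have IH m' : forall k : 'I_N, enkf_analysis A b H V U0' D' N m' k w' =
    enkf_analysis A b H V U0 D N m' (s k) w.
  elim: m' => [|m' IH] j; first exact: eU.
  rewrite /= /analysis /forecast IH eD -[in RHS](sample_cov_perm _ s).
  by under [X in sample_cov X]eq_fun do rewrite IH.
by case: m => [|m]; rewrite /= /forecast ?IH.
Qed.

(** Sequence 0 of a path is reserved for the initial vectors, and sequence [m >= 1] holds the data
    at time [m]. *)
Definition driving_dim (j : nat) : nat := if j is j'.+1 then q j'.+1 else n.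

Definition path_initial (k : nat) (x : path R driving_dim) : 'cV[R]_n := x 0%N k.

Definition path_data (m k : nat) : path R driving_dim -> 'cV[R]_(q m) :=
  if m is m'.+1 then fun x => x m'.+1 k else fun=> 0.

Lemma measurable_path_initial k : measurable_fun setT (path_initial k).
Proof. exact: (@measurable_coord R driving_dim 0%N k). Qed.

Lemma measurable_path_data m k : measurable_fun setT (path_data m.+1 k).
Proof. exact: (@measurable_coord R driving_dim m.+1 k). Qed.

End filters_on_paths.

Section exchangeability.
Context {R : realType} {d : measure_display} {T : measurableType d}.
Variables (P : probability T R) (n : nat) (q : nat -> nat).
Variables (U0 : nat -> {RV P >-> 'cV[R]_n}).
Variables (D : forall m : nat, nat -> {RV P >-> 'cV[R]_(q m)}).

Definition driving (j : nat) : nat -> {RV P >-> 'cV[R]_(driving_dim n q j)} :=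
  if j is j'.+1 then D j'.+1 else U0.

Hypothesis iidU0 : iid U0.
Hypothesis iidD : forall m, (1 <= m)%N -> iid (D m).
Hypothesis indUD : mutually_independent P
  (fun m : nat => if m is 0%N then sigma_seq U0 else sigma_seq (D m)).

Lemma iid_driving j : iid (driving j).
Proof. by case: j => [|j]; [exact: iidU0|exact: iidD]. Qed.

Lemma independent_driving :
  mutually_independent P (fun j => sigma_seq (driving j)).
Proof.
rewrite (_ : (fun j => _) =
  (fun m : nat => if m is 0%N then sigma_seq U0 else sigma_seq (D m)))//.
by apply/funext => -[].
Qed.

Variables (A : nat -> 'M[R]_n) (b : nat -> 'cV[R]_n).
Variables (H : forall m, 'M[R]_(q m, n)) (V : forall m, 'M[R]_(q m)).

Lemma exchangeable_enkf_reference m N :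
  exchangeable P (fun (k : 'I_N) w =>
    col_mx (enkf A b H V U0 D N m k w) (reference P A b H V U0 D m k w)).
Proof.
set K := reference_gain A b H V P U0 D.
have mU0 k : measurable_fun setT (U0 k) by exact: measurable_funPT.
have mD j k : measurable_fun setT (D j k) by exact: measurable_funPT.
split=> [k|s B mB].
  apply: measurable_col_mx; first exact: measurable_enkf.
  by rewrite reference_gained; exact: measurable_gained.
(* The stacked vector as a function of the path, with the gains [K] of the original space. *)
pose Z (k : 'I_N) (x : path R (driving_dim n q)) : 'cV[R]_(n + n) :=
  col_mx (enkf A b H V (@path_initial R n q) (@path_data R n q) N m k x)
         (gained A b H K (@path_initial R n q) (@path_data R n q) m k x).
pose F (x : path R (driving_dim n q)) := [tuple Z k x | k < N].
have mF : measurable_fun setT F.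
  apply/measurable_fun_tnthP => i.
  rewrite (_ : _ \o _ = Z i); last by apply/funext => x /=; rewrite tnth_mktuple.
  apply: measurable_col_mx.
    apply: measurable_enkf => [k|j k]; first exact: measurable_path_initial.
    exact: measurable_path_data.
  apply: measurable_gained => [k|j k]; first exact: measurable_path_initial.
  exact: measurable_path_data.
have mFB : measurable (F @^-1` B) by rewrite -[X in measurable X]setTI; exact: mF.
(* Invariance in law is stated for reindexings of all naturals: the permutation is extended by the
   identity from [N] on. *)
pose ext (t : {perm 'I_N}) (k : nat) : nat :=
  if insub k is Some i then val (t i) else k.
have extE t (k : 'I_N) : ext t k = t k.
  by rewrite /ext insubT//= => kN; congr (val (t _)); exact: val_inj.
have extK : cancel (ext s) (ext s^-1%g).
  move=> k; have [kN|Nk] := ltnP k N.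
    by rewrite -[k]/(val (Ordinal kN)) !extE permK.
  by rewrite {2}/ext insubF ?ltnNge ?Nk// /ext insubF// ltnNge Nk.
have ZE (e : nat -> nat) (t : {perm 'I_N}) (k : 'I_N) w :
    (forall k : 'I_N, e k = t k) ->
    Z k (fun j l => driving j (e l) w) =
    col_mx (enkf A b H V U0 D N m (t k) w) (reference P A b H V U0 D m (t k) w).
  move=> et; rewrite /Z reference_gained; congr col_mx.
    apply: enkf_transport => [l|j l]; by rewrite -et.
  by apply: gained_transport => [|j]; rewrite -et.
have law := driving_path_shuffle iid_driving independent_driving extK mFB.
transitivity (P ((fun w j k => driving j (ext s k) w) @^-1` (F @^-1` B))).
  congr (P _); apply/seteqP; split => w /=; congr (B _);
    apply: eq_from_tnth => k; rewrite !tnth_mktuple (ZE _ s)// => l; exact: extE.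
rewrite -law; congr (P _); apply/seteqP; split => w /=; congr (B _);
  apply: eq_from_tnth => k; rewrite !tnth_mktuple.
  by rewrite (ZE id 1%g) => [|l]; rewrite perm1.
by rewrite (ZE id 1%g) => [|l]; rewrite perm1.
Qed.

End exchangeability.

(** * Moment calculus *)

Section power_inequalities.
Context {R : realFieldType}.

(** Chebyshev's sum inequality: the difference of the two sides is half the double sum of
    [(a i - a j) * (a i ^+ r - a j ^+ r)], whose factors have the same sign. *)
Lemma chebyshev_sum_exp (I : finType) (a : I -> R) r : (forall i, 0 <= a i) ->
  (\sum_i a i) * (\sum_i a i ^+ r) <= #|I|%:R * \sum_i a i ^+ r.+1.
Proof.
move=> a0.
have -> : #|I|%:R * \sum_i a i ^+ r.+1 =
    2^-1 * \sum_i \sum_j (a i ^+ r.+1 + a j ^+ r.+1).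
  have -> : \sum_i \sum_j (a i ^+ r.+1 + a j ^+ r.+1) =
      #|I|%:R * (\sum_i a i ^+ r.+1) + #|I|%:R * (\sum_i a i ^+ r.+1).
    under eq_bigr => i _ do rewrite big_split/= sumr_const -mulr_natl.
    by rewrite big_split/= -mulr_sumr sumr_const -[X in _ + X]mulr_natl.
  by lra.
have -> : (\sum_i a i) * (\sum_i a i ^+ r) =
    2^-1 * \sum_i \sum_j (a i * a j ^+ r + a j * a i ^+ r).
  have -> : \sum_i \sum_j (a i * a j ^+ r + a j * a i ^+ r) =
      (\sum_i a i) * (\sum_i a i ^+ r) + (\sum_i a i) * (\sum_i a i ^+ r).
    under eq_bigr => i _ do rewrite big_split/= -mulr_sumr -mulr_suml.
    by rewrite big_split/= -mulr_suml -mulr_sumr.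
  by lra.
apply: ler_wpM2l; first by rewrite invr_ge0.
apply: ler_sum => i _; apply: ler_sum => j _.
rewrite -subr_ge0.
have -> : a i ^+ r.+1 + a j ^+ r.+1 - (a i * a j ^+ r + a j * a i ^+ r) =
    (a i - a j) * (a i ^+ r - a j ^+ r) by rewrite !exprS; ring.
have [aij|/ltW aji] := leP (a i) (a j).
  by rewrite mulr_le0 ?subr_le0// lerXn2r// nnegrE.
by rewrite mulr_ge0 ?subr_ge0// lerXn2r// nnegrE.
Qed.

(** Each step of the induction on [r] is Chebyshev's sum inequality. *)
Lemma power_mean (I : finType) (a : I -> R) r : (0 < #|I|)%N ->
  (forall i, 0 <= a i) ->
  (#|I|%:R^-1 * \sum_i a i) ^+ r <= #|I|%:R^-1 * \sum_i a i ^+ r.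
Proof.
move=> I0 a0; have c0 : 0 < #|I|%:R :> R by rewrite ltr0n.
elim: r => [|r IH].
  by rewrite expr0 sumr_const mulVf// gt_eqF.
rewrite exprS; apply: (le_trans (ler_wpM2l _ IH)).
  by rewrite mulr_ge0 ?sumr_ge0// invr_ge0 ltW.
rewrite mulrACA -mulrA ler_pM2l ?invr_gt0//.
by rewrite ler_pdivrMl// chebyshev_sum_exp.
Qed.

Lemma ler_normD_exp (x y : R) r :
  `|x + y| ^+ r <= 2 ^+ r * `|x| ^+ r + 2 ^+ r * `|y| ^+ r.
Proof.
rewrite -!exprMn; have [xy|/ltW yx] := leP `|x| `|y|.
  apply: ler_wpDl; first by rewrite exprn_ge0// mulr_ge0.
  apply: lerXn2r; rewrite ?nnegrE ?mulr_ge0//.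
  by apply: (le_trans (ler_normD _ _)); lra.
apply: ler_wpDr; first by rewrite exprn_ge0// mulr_ge0.
apply: lerXn2r; rewrite ?nnegrE ?mulr_ge0//.
by apply: (le_trans (ler_normD _ _)); lra.
Qed.

(** Young's inequality, from the square of [|x| ^+ r - e * |y| ^+ r]. The free weight is what makes
    products vanish: the small [e] goes to a bounded factor, the large [e^-1] to a vanishing one. *)
Lemma ler_normM_exp (x y e : R) r : 0 < e ->
  `|x * y| ^+ r <= e^-1 * `|x| ^+ (2 * r) + e * `|y| ^+ (2 * r).
Proof.
move=> e0; rewrite normrM exprMn mulnC !exprM.
set a := `|x| ^+ r; set c := `|y| ^+ r.
have : 0 <= e^-1 * (a - e * c) ^+ 2 by rewrite mulr_ge0 ?sqr_ge0// invr_ge0 ltW.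
have -> : e^-1 * (a - e * c) ^+ 2 = e^-1 * a ^+ 2 + e * c ^+ 2 - 2 * (a * c).
  by field; rewrite gt_eqF.
have ac : 0 <= a * c by rewrite mulr_ge0// exprn_ge0.
lra.
Qed.

End power_inequalities.

Section moment_calculus.
Context {R : realType} {d : measure_display} {T : measurableType d}.
Variable P : probability T R.

Definition moment (r : nat) (f : T -> R) : \bar R :=
  (\int[P]_w (`|f w| ^+ r)%:E)%E.

Lemma measurable_moment r (f : T -> R) : measurable_fun setT f ->
  measurable_fun setT (fun w => (`|f w| ^+ r)%:E).
Proof.
move=> mf; apply/measurable_EFinP; apply: measurable_funX.
exact: measurableT_comp.
Qed.

Lemma moment_le_comb r s t (a c : R) (f g h : T -> R) : 0 <= a -> 0 <= c ->
  measurable_fun setT f -> measurable_fun setT g -> measurable_fun setT h ->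
  (forall w, `|h w| ^+ r <= a * `|f w| ^+ s + c * `|g w| ^+ t) ->
  (moment r h <= a%:E * moment s f + c%:E * moment t g)%E.
Proof.
move=> a0 c0 mf mg mh le_hfg.
have mfs := measurable_moment s mf; have mgt := measurable_moment t mg.
have maf : measurable_fun setT (fun w => a%:E * (`|f w| ^+ s)%:E)%E.
  exact: measurable_funeM.
have mcg : measurable_fun setT (fun w => c%:E * (`|g w| ^+ t)%:E)%E.
  exact: measurable_funeM.
rewrite /moment -!ge0_integralZl_EFin//.
rewrite -ge0_integralD//; last 2 first.
- by move=> w _; rewrite mule_ge0// lee_fin// exprn_ge0.
- by move=> w _; rewrite mule_ge0// lee_fin// exprn_ge0.
apply: ge0_le_integral => //.
- exact: measurable_moment.
- exact: emeasurable_funD.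
- by move=> w _; rewrite -!EFinM -EFinD lee_fin.
Qed.

(** Index [N] stands for ensemble size [N + 2]: the size is then at least 2 and a member always
    exists. *)
Definition family := forall N : nat, 'I_N.+2 -> T -> R.

(** The bound is uniform over the members but starts at a rank depending on [r], so that vanishing
    families are bounded. *)
Definition bounded_moments (F : family) :=
  (forall N k, measurable_fun setT (F N k)) /\
  forall r, exists C N0, forall N k, (N0 <= N)%N -> (moment r (F N k) <= C%:E)%E.

Definition vanishing_moment (r : nat) (F : family) :=
  forall e, 0 < e -> exists N0, forall N k,
    (N0 <= N)%N -> (moment r (F N k) <= e%:E)%E.

(** Order 0 is excluded because that moment is always 1. *)
Definition vanishing_moments (F : family) :=
  (forall N k, measurable_fun setT (F N k)) /\
  forall r, (0 < r)%N -> vanishing_moment r F.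

Lemma integral_probability_cst (c : R) : (\int[P]_w c%:E = c%:E)%E.
Proof.
by have := expectation_cst P c; rewrite unlock.
Qed.

Lemma family_ext (F G : family) :
  (forall N k w, F N k w = G N k w) -> F = G.
Proof.
move=> FG; apply: functional_extensionality_dep => N.
by apply/funext => k; apply/funext => w.
Qed.

Lemma moment0 f : moment 0 f = 1%E.
Proof.
rewrite /moment; under eq_integral do rewrite expr0.
exact: integral_probability_cst.
Qed.

Lemma vanishing_bounded F : vanishing_moments F -> bounded_moments F.
Proof.
move=> [mF SF]; split => // r; exists 1.
case: r => [|r]; last by have [] := SF r.+1 isT 1 ltr01; move=> N0 ?; exists N0.
by exists 0%N => N k _; rewrite moment0.
Qed.

Lemma bounded_moments_comb (F G H : family) :
  bounded_moments F -> bounded_moments G ->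
  (forall N k, measurable_fun setT (H N k)) ->
  (forall r, exists a c s t, [/\ 0 <= a, 0 <= c & forall N k w,
    `|H N k w| ^+ r <= a * `|F N k w| ^+ s + c * `|G N k w| ^+ t]) ->
  bounded_moments H.
Proof.
move=> [mF BF] [mG BG] mH le_H; split => // r.
have [a [c [s [t [a0 c0 le_r]]]]] := le_H r.
have [C1 [N1 BF1]] := BF s; have [C2 [N2 BG2]] := BG t.
exists (a * C1 + c * C2), (maxn N1 N2) => N k; rewrite geq_max => /andP[N1N N2N].
apply: (le_trans (moment_le_comb a0 c0 _ _ _ (le_r N k))) => //.
by rewrite EFinD !EFinM leeD// lee_wpmul2l// ?lee_fin// ?BF1 ?BG2.
Qed.

(** [a] may blow up as [e] tends to 0, since it multiplies a vanishing moment; the merely bounded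
    moment of [G] carries the small weight. A single order [s] of [F] has to vanish, which allows
    interpolation from second moments. *)
Lemma vanishing_moments_comb (F G H : family) :
  (forall N k, measurable_fun setT (F N k)) -> bounded_moments G ->
  (forall N k, measurable_fun setT (H N k)) ->
  (forall r, (0 < r)%N -> exists s t, vanishing_moment s F /\ forall e, 0 < e ->
    exists2 a, 0 <= a & forall N k w,
    `|H N k w| ^+ r <= a * `|F N k w| ^+ s + e * `|G N k w| ^+ t) ->
  vanishing_moments H.
Proof.
move=> mF [mG BG] mH le_H; split => // r r0 e e0.
have [s [t [SF le_r]]] := le_H r r0.
have [C [N2 BG2]] := BG t.
have C0 : 0 < `|C| + 1 by rewrite ltr_wpDl.
(* Each of the two terms may cost [e / 2]; the added 1 guards against a zero denominator. *)
pose e' := e / 2 / (`|C| + 1).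
have e'0 : 0 < e' by rewrite !divr_gt0.
have [a a0 le_a] := le_r e' e'0.
have a10 : 0 < a + 1 by rewrite ltr_wpDl.
have [|N1 SF1] := SF (e / 2 / (a + 1)); first by rewrite !divr_gt0.
exists (maxn N1 N2) => N k; rewrite geq_max => /andP[N1N N2N].
apply: (le_trans (moment_le_comb a0 (ltW e'0) _ _ _ (le_a N k))) => //.
apply: (@le_trans _ _ ((e / 2)%:E + (e / 2)%:E)%E); last first.
  by rewrite -EFinD lee_fin; lra.
apply: leeD.
  apply: (@le_trans _ _ (a%:E * (e / 2 / (a + 1))%:E)%E).
    by rewrite lee_wpmul2l// ?lee_fin// SF1.
  rewrite -EFinM lee_fin mulrCA ler_piMr//; first by rewrite divr_ge0// ltW.
  by rewrite ler_pdivrMr// mul1r lerDl.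
apply: (@le_trans _ _ (e'%:E * C%:E)%E).
  by rewrite lee_wpmul2l// ?lee_fin ?BG2// ltW.
rewrite -EFinM lee_fin /e' mulrAC ler_pdivrMr// ler_wpM2l//; first by rewrite divr_ge0// ltW.
by rewrite (le_trans (ler_norm _))// lerDl.
Qed.

Lemma bounded_moments_measurable F N k :
  bounded_moments F -> measurable_fun setT (F N k).
Proof. by case. Qed.

Lemma vanishing_moments_measurable F N k :
  vanishing_moments F -> measurable_fun setT (F N k).
Proof. by case. Qed.

Lemma bounded_moments_cst (c : R) : bounded_moments (fun _ _ _ => c).
Proof.
split=> [//|r]; exists (`|c| ^+ r), 0%N => N k _.
by rewrite /moment integral_probability_cst.
Qed.

Lemma bounded_moments_le (F G : family) :
  bounded_moments G -> (forall N k, measurable_fun setT (F N k)) ->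
  (forall N k w, `|F N k w| <= `|G N k w|) -> bounded_moments F.
Proof.
move=> BG mF le_FG; apply: (bounded_moments_comb BG BG mF) => r.
exists 1, 0, r, r; split => // N k w; rewrite mul1r mul0r addr0.
by apply: lerXn2r => //; rewrite nnegrE.
Qed.

Lemma vanishing_moments_le (F G : family) :
  vanishing_moments G -> (forall N k, measurable_fun setT (F N k)) ->
  (forall N k w, `|F N k w| <= `|G N k w|) -> vanishing_moments F.
Proof.
move=> SG mF le_FG.
have [mG SGr] := SG.
apply: (vanishing_moments_comb mG (vanishing_bounded SG) mF) => r r0.
exists r, r; split => [|e e0]; first exact: SGr.
 exists 1 => // N k w; rewrite mul1r.
apply: ler_wpDr; first by rewrite mulr_ge0 ?exprn_ge0// ltW.
by apply: lerXn2r => //; rewrite nnegrE.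
Qed.

Lemma bounded_momentsD (F G : family) :
  bounded_moments F -> bounded_moments G ->
  bounded_moments (fun N k w => F N k w + G N k w).
Proof.
move=> BF BG; apply: (bounded_moments_comb BF BG) => [N k|r].
  by apply: measurable_funD; exact: bounded_moments_measurable.
exists (2 ^+ r), (2 ^+ r), r, r; split => [||N k w]; rewrite ?exprn_ge0//.
exact: ler_normD_exp.
Qed.

Lemma bounded_momentsM (F G : family) :
  bounded_moments F -> bounded_moments G ->
  bounded_moments (fun N k w => F N k w * G N k w).
Proof.
move=> BF BG; apply: (bounded_moments_comb BF BG) => [N k|r].
  by apply: measurable_funM; exact: bounded_moments_measurable.
exists 1^-1, 1, (2 * r)%N, (2 * r)%N; split => [||N k w]; rewrite ?invr1//.
by rewrite -[X in X * _ + _]invr1; exact: ler_normM_exp.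
Qed.

Lemma vanishing_momentsMl (F G : family) :
  vanishing_moments F -> bounded_moments G ->
  vanishing_moments (fun N k w => F N k w * G N k w).
Proof.
move=> SF BG; have [mF SFr] := SF.
apply: (vanishing_moments_comb mF BG) => [N k|r r0].
  by apply: measurable_funM; [exact: vanishing_moments_measurable|
    exact: bounded_moments_measurable].
exists (2 * r)%N, (2 * r)%N; split; first by apply: SFr; rewrite muln_gt0.
move=> e e0; exists e^-1; first by rewrite invr_ge0 ltW.
by move=> N k w; exact: ler_normM_exp.
Qed.

Lemma vanishing_momentsMr (F G : family) :
  bounded_moments F -> vanishing_moments G ->
  vanishing_moments (fun N k w => F N k w * G N k w).
Proof.
move=> BF SG; have := vanishing_momentsMl SG BF.
by congr vanishing_moments; apply: family_ext => N k w; rewrite mulrC.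
Qed.

Lemma vanishing_momentsD (F G : family) :
  vanishing_moments F -> vanishing_moments G ->
  vanishing_moments (fun N k w => F N k w + G N k w).
Proof.
move=> [mF SF] [mG SG]; have mFG N k : measurable_fun setT (fun w => F N k w + G N k w).
  exact: measurable_funD.
split => // r r0 e e0.
have c0 : 0 < 2 ^+ r :> R by rewrite exprn_gt0.
have e'0 : 0 < e / 2 / 2 ^+ r by rewrite !divr_gt0.
have [N1 SF1] := SF r r0 _ e'0; have [N2 SG2] := SG r r0 _ e'0.
exists (maxn N1 N2) => N k; rewrite geq_max => /andP[N1N N2N].
apply: (le_trans (moment_le_comb (ltW c0) (ltW c0) _ _ _
  (fun w => ler_normD_exp (F N k w) (G N k w) r))) => //.
apply: (@le_trans _ _ ((2 ^+ r)%:E * (e / 2 / 2 ^+ r)%:E +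
    (2 ^+ r)%:E * (e / 2 / 2 ^+ r)%:E)%E).
  by apply: leeD; rewrite lee_wpmul2l// ?lee_fin ?SF1 ?SG2// ltW.
rewrite -!EFinM -EFinD lee_fin mulrC divfK ?gt_eqF//; lra.
Qed.

Lemma vanishing_moments0 : vanishing_moments (fun _ _ _ => 0).
Proof.
split=> // r r0 e e0; exists 0%N => N k _.
rewrite /moment; under eq_integral do rewrite normr0 expr0n gtn_eqF//.
by rewrite integral0 lee_fin ltW.
Qed.

Lemma vanishing_moments_cvg0 (c : nat -> R) : c @ \oo --> 0 ->
  vanishing_moments (fun N _ _ => c N).
Proof.
move=> c0; split=> // r r0 e e0.
have [|N0 _ cN0] := (cvgr0Pnorm_le _).1 c0 (Num.min 1 e).
  by rewrite lt_min ltr01.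
exists N0 => N k N0N; rewrite /moment integral_probability_cst.
have := cN0 N N0N; rewrite /= le_min lee_fin => /andP[c1 ce].
by rewrite (le_trans _ ce)// ler_iXnr.
Qed.

Lemma bounded_moments_sum (I : Type) (s : seq I) (F : I -> family) :
  (forall i, bounded_moments (F i)) ->
  bounded_moments (fun N k w => \sum_(i <- s) F i N k w).
Proof.
move=> BF; elim: s => [|i s IH].
  have := bounded_moments_cst 0.
  by congr bounded_moments; apply: family_ext => N k w; rewrite big_nil.
have := bounded_momentsD (BF i) IH.
by congr bounded_moments; apply: family_ext => N k w; rewrite big_cons.
Qed.

Lemma vanishing_moments_sum (I : Type) (s : seq I) (F : I -> family) :
  (forall i, vanishing_moments (F i)) ->
  vanishing_moments (fun N k w => \sum_(i <- s) F i N k w).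
Proof.
move=> SF; elim: s => [|i s IH].
  have := vanishing_moments0.
  by congr vanishing_moments; apply: family_ext => N k w; rewrite big_nil.
have := vanishing_momentsD (SF i) IH.
by congr vanishing_moments; apply: family_ext => N k w; rewrite big_cons.
Qed.

Lemma bounded_momentsN (F : family) :
  bounded_moments F -> bounded_moments (fun N k w => - F N k w).
Proof.
move=> BF; apply: (bounded_moments_le BF) => [N k|N k w]; last by rewrite normrN.
by apply: measurable_funN; exact: bounded_moments_measurable.
Qed.

Lemma vanishing_momentsN (F : family) :
  vanishing_moments F -> vanishing_moments (fun N k w => - F N k w).
Proof.
move=> SF; apply: (vanishing_moments_le SF) => [N k|N k w]; last by rewrite normrN.
by apply: measurable_funN; exact: vanishing_moments_measurable.
Qed.

Definition avg N (f : 'I_N.+2 -> T -> R) : T -> R :=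
  fun w => N.+2%:R^-1 * \sum_k f k w.

Lemma measurable_avg N (f : 'I_N.+2 -> T -> R) :
  (forall k, measurable_fun setT (f k)) -> measurable_fun setT (avg f).
Proof.
by move=> mf; apply: measurable_funM => //; exact: measurable_sum.
Qed.

(** By convexity of the [r]-th power, a bound uniform over the members is kept with the same
    constant, whatever their dependence. *)
Lemma moment_avg_le N (f : 'I_N.+2 -> T -> R) r (C : R) :
  (forall k, measurable_fun setT (f k)) ->
  (forall k, moment r (f k) <= C%:E)%E -> (moment r (avg f) <= C%:E)%E.
Proof.
move=> mf FC.
apply: (@le_trans _ _
  (\int[P]_w ((N.+2%:R^-1)%:E * \sum_(k < N.+2) (`|f k w| ^+ r)%:E))%E).
  have mS : measurable_fun setT
      (fun w => ((N.+2%:R^-1)%:E * \sum_(k < N.+2) (`|f k w| ^+ r)%:E)%E).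
    apply: measurable_funeM; apply: emeasurable_sum => j.
    exact: measurable_moment.
  apply: ge0_le_integral => //.
  - by apply: measurable_moment; exact: measurable_avg.
  - move=> w _; rewrite sumEFin -EFinM lee_fin /avg.
    have := @power_mean _ 'I_N.+2 (fun k => `|f k w|) r.
    rewrite card_ord => /(_ isT (fun=> normr_ge0 _)).
    apply: le_trans; apply: lerXn2r; rewrite ?nnegrE//.
      by rewrite mulr_ge0 ?invr_ge0 ?sumr_ge0.
    by rewrite normrM ger0_norm ?invr_ge0// ler_wpM2l ?invr_ge0// ler_norm_sum.
rewrite ge0_integralZl_EFin//; last 2 first.
- by move=> w _; apply: sume_ge0 => j _; rewrite lee_fin exprn_ge0.
- by apply: emeasurable_sum => j; exact: measurable_moment.
rewrite ge0_integral_sum//; last first.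
  by move=> j; exact: measurable_moment.
apply: (@le_trans _ _ ((N.+2%:R^-1)%:E * \sum_(j < N.+2) C%:E)%E).
  by rewrite lee_wpmul2l ?lee_fin ?invr_ge0//; apply: lee_sum => j _; exact: FC.
rewrite sumEFin -EFinM lee_fin sumr_const card_ord.
by rewrite -[C *+ _]mulr_natl mulKf.
Qed.

Lemma bounded_moments_avg F : bounded_moments F -> 
  bounded_moments (fun N _ => avg (F N)).
Proof.
move=> [mF BF]; split=> [N _|]; first exact: measurable_avg.
move=> r; have [C [N0 CN0]] := BF r; exists C, N0 => N k N0N.
by apply: moment_avg_le => // j; exact: CN0.
Qed.

Lemma vanishing_moments_avg F : vanishing_moments F -> 
  vanishing_moments (fun N _ => avg (F N)).
Proof.
move=> [mF SF]; split=> [N _|]; first exact: measurable_avg.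
move=> r r0 e e0; have [N0 CN0] := SF r r0 e e0; exists N0 => N k N0N.
by apply: moment_avg_le => // j; exact: CN0.
Qed.

Lemma bounded_integrable F : bounded_moments F ->
  exists N0, forall N k, (N0 <= N)%N -> P.-integrable setT (EFin \o F N k).
Proof.
move=> [mF BF]; have [C [N0 CN0]] := BF 1%N; exists N0 => N k N0N.
apply/integrableP; split; first exact/measurable_EFinP.
apply: (@le_lt_trans _ _ C%:E); last exact: ltry.
by have := CN0 N k N0N; rewrite /moment; under eq_integral do rewrite expr1.
Qed.

End moment_calculus.

Arguments family R {d} T.

(** * Law of large numbers and sample covariances *)

Section law_of_large_numbers.
Context {R : realType} {d : measure_display} {T : measurableType d}.
Variable P : probability T R.

(** The sequence [W] does not change with [N], and [k0] belongs to every large enough ensemble,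
    where the uniform bound applies to it. *)
Lemma bounded_moments_term (W : nat -> T -> R) k0 :
  bounded_moments P (fun N (k : 'I_N.+2) => W k) ->
  bounded_moments P (fun N (_ : 'I_N.+2) => W k0).
Proof.
move=> [mW BW]; split=> [N _|r].
  by have := mW k0 (inord k0); rewrite inordK// ltnS leqnSn.
have [C [N0 CN0]] := BW r; exists C, 0%N => N _ _.
have := CN0 (maxn N0 k0) (inord k0) (leq_maxl _ _).
by rewrite inordK// ltnS (leq_trans (leq_maxr N0 k0)).
Qed.

Lemma bounded_moments_term_integrable (W : T -> R) :
  bounded_moments P (fun N (_ : 'I_N.+2) => W) -> P.-integrable setT (EFin \o W).
Proof.
by move=> BW; have [N0 iW] := bounded_integrable BW; exact: (iW N0 ord0).
Qed.

(** Only the diagonal of the expanded square survives, and it contributes at most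
    [|C| / (N + 2)]. *)
Lemma moment2_avg_uncorrelated (W : nat -> T -> R) :
  bounded_moments P (fun N (k : 'I_N.+2) => W k) ->
  (forall k l, k != l -> (\int[P]_w (W k w * W l w)%:E = 0)%E) ->
  vanishing_moment P 2 (fun N _ => avg (fun k : 'I_N.+2 => W k)).
Proof.
move=> BW W0.
have iW k l : P.-integrable setT (fun w => (W k w * W l w)%:E).
  apply: bounded_moments_term_integrable.
  exact: bounded_momentsM (bounded_moments_term k BW) (bounded_moments_term l BW).
have [mW /(_ 2)[C [N0 CN0]]] := BW.
move=> e e0; exists (maxn N0 (Num.truncn (`|C| / e))) => N _.
rewrite geq_max => /andP[N0N CN].
have n0 : 0 < N.+2%:R :> R by rewrite ltr0n.
have C0 : `|C| / e <= N.+2%:R.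
  rewrite (le_trans (ltW (truncnS_gt _)))// ler_nat ltnS.
  exact: leq_trans CN _.
rewrite /moment.
under eq_integral => w _.
  rewrite -normrX ger0_norm ?sqr_ge0// /avg exprMn expr2 expr2.
  rewrite [in X in _ * X]mulr_suml.
  under [in X in _ * X]eq_bigr do rewrite mulr_sumr.
  rewrite pair_big/= EFinM -sumEFin.
  over.
rewrite integralZl//=; last first.
  by apply: integrable_sum => // -[k l] _; exact: iW.
rewrite integral_sum//.
rewrite -(pair_big xpredT xpredT (fun k l : 'I_N.+2 => \int[P]_w (W k w * W l w)%:E)%E)/=.
rewrite (eq_bigr (fun k : 'I_N.+2 => moment P 2 (W k))); last first.
  move=> k _; rewrite (bigD1 k)//= big1 ?adde0.
    by apply: eq_integral => w _; rewrite -normrX ger0_norm ?sqr_ge0// expr2.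
  by move=> l lk; apply: W0; rewrite eq_sym.
apply: (@le_trans _ _ ((N.+2%:R^-1 * N.+2%:R^-1)%:E * \sum_(k < N.+2) `|C|%:E)%E).
  rewrite lee_wpmul2l ?lee_fin ?mulr_ge0 ?invr_ge0//.
  apply: lee_sum => k _; apply: (le_trans (CN0 N k N0N)).
  by rewrite lee_fin ler_norm.
rewrite sumEFin -EFinM lee_fin sumr_const card_ord.
rewrite -[(`|C| *+ _)]mulr_natl -mulrA mulKf// ler_pdivrMl//.
by rewrite -ler_pdivrMr.
Qed.

(* Only the second moment is computed; [|Z|^(r+1)] is interpolated between [Z^2]
   and the bounded moment [Z^(2r)]. *)
Lemma vanishing_avg_uncorrelated (W : nat -> T -> R) :
  bounded_moments P (fun N (k : 'I_N.+2) => W k) ->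
  (forall k l, k != l -> (\int[P]_w (W k w * W l w)%:E = 0)%E) ->
  vanishing_moments P (fun N _ => avg (fun k : 'I_N.+2 => W k)).
Proof.
move=> BW W0; have BZ := bounded_moments_avg BW.
have [mZ _] := BZ.
apply: (vanishing_moments_comb mZ BZ mZ) => -[//|r] _.
exists 2%N, (2 * r)%N; split; first exact: moment2_avg_uncorrelated.
move=> e e0; exists e^-1; first by rewrite invr_ge0 ltW.
move=> N k w; set z := avg _ _.
have := @ler_normM_exp R z (z ^+ r) e 1 e0.
by rewrite muln1 expr1 -exprS normrX [(`|z ^+ r|)]normrX -exprM mulnC.
Qed.

End law_of_large_numbers.

Section sample_covariance.
Context {R : realType} {d : measure_display} {T : measurableType d}.
Variable P : probability T R.

Lemma avgB N (f g : 'I_N.+2 -> T -> R) w :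
  avg (fun k w => f k w - g k w) w = avg f w - avg g w.
Proof. by rewrite /avg sumrB mulrBr. Qed.

Definition scov N (f g : 'I_N.+2 -> T -> R) (w : T) : R :=
  (N.+2%:R - 1)^-1 * \sum_k (f k w - avg f w) * (g k w - avg g w).

Lemma natr_pred2 N : N.+2%:R - 1 = N.+1%:R :> R.
Proof. by rewrite -natr1 addrK. Qed.

(** The unbiased normalisation exceeds that of an average by the factor [(N + 2) / (N + 1)], written
    so as to isolate a harmonic sequence tending to 0. *)
Lemma scov_avg_centered N (f g : 'I_N.+2 -> T -> R) w :
  scov f g w = (1 + N.+1%:R^-1) *
    avg (fun k w => (f k w - avg f w) * (g k w - avg g w)) w.
Proof.
rewrite /scov natr_pred2.
pose S := \sum_k (f k w - avg f w) * (g k w - avg g w).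
rewrite -/S -[RHS]/((1 + N.+1%:R^-1) * (N.+2%:R^-1 * S)).
have n2 : N.+2%:R != 0 :> R by rewrite pnatr_eq0.
move: n2; rewrite -(natr1 N.+1); set x := N.+1%:R => x1.
have x0 : x != 0 by rewrite pnatr_eq0.
by clearbody x S; field; rewrite x0 x1.
Qed.

Lemma scov_avg N (f g : 'I_N.+2 -> T -> R) w :
  scov f g w = (1 + N.+1%:R^-1) *
    (avg (fun k w => f k w * g k w) w - avg f w * avg g w).
Proof.
rewrite scov_avg_centered; congr (_ * _).
have n2 : N.+2%:R != 0 :> R by rewrite pnatr_eq0.
rewrite {1}/avg.
rewrite (eq_bigr (fun k => f k w * g k w - f k w * avg g w -
    avg f w * g k w + avg f w * avg g w)); last by move=> k _; ring.
rewrite big_split/= sumrB sumrB -mulr_suml -mulr_sumr sumr_const card_ord.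
rewrite -[_ *+ N.+2]mulr_natl /avg; set x := N.+2%:R.
by field.
Qed.

Let factor_bounded : bounded_moments P (fun N _ _ => 1 + N.+1%:R^-1 : R).
Proof.
apply: (bounded_moments_le (bounded_moments_cst P 2)) => // N k w.
rewrite !ger0_norm ?addr_ge0 ?invr_ge0//.
by rewrite [leRHS]mulr2n lerD2l invf_le1// ler1n.
Qed.

Lemma bounded_moments_centered (F : family R T) : bounded_moments P F ->
  bounded_moments P (fun N k w => F N k w - avg (F N) w).
Proof.
move=> BF; apply: bounded_momentsD => //; apply: bounded_momentsN.
exact: bounded_moments_avg.
Qed.

Lemma vanishing_moments_centered (F : family R T) : vanishing_moments P F ->
  vanishing_moments P (fun N k w => F N k w - avg (F N) w).
Proof.
move=> BF; apply: vanishing_momentsD => //; apply: vanishing_momentsN.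
exact: vanishing_moments_avg.
Qed.

(** On centred families, [F G - F' G' = (F - F') G + F' (G - G')]: each term is a vanishing factor
    times a bounded one. *)
Lemma vanishing_scovB (F F' G G' : family R T) :
  bounded_moments P F' -> bounded_moments P G ->
  vanishing_moments P (fun N k w => F N k w - F' N k w) ->
  vanishing_moments P (fun N k w => G N k w - G' N k w) ->
  vanishing_moments P
    (fun N _ w => scov (F N) (G N) w - scov (F' N) (G' N) w).
Proof.
move=> BF' BG SF SG.
have S1 := vanishing_momentsMl (vanishing_moments_centered SF)
  (bounded_moments_centered BG).
have S2 := vanishing_momentsMr (bounded_moments_centered BF')
  (vanishing_moments_centered SG).
have := vanishing_momentsMr factor_bounded
  (vanishing_moments_avg (vanishing_momentsD S1 S2)).
congr vanishing_moments; apply: family_ext => N k w.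
rewrite !scov_avg_centered -mulrBr -avgB; congr (_ * avg _ _).
by apply/funext => j; apply/funext => v; rewrite !avgB; ring.
Qed.

(** The error splits into that of the mean product, that of the product of means, and the harmonic
    part of the normalisation times a bounded family. *)
Lemma vanishing_scov_lln (F G : family R T) (m1 m2 m12 : R) :
  bounded_moments P F -> bounded_moments P G ->
  vanishing_moments P (fun N _ w => avg (F N) w - m1) ->
  vanishing_moments P (fun N _ w => avg (G N) w - m2) ->
  vanishing_moments P
    (fun N _ w => avg (fun k w => F N k w * G N k w) w - m12) ->
  vanishing_moments P (fun N _ w => scov (F N) (G N) w - (m12 - m1 * m2)).
Proof.
move=> BF BG S1 S2 S12.
have BFG := bounded_moments_avg (bounded_momentsM BF BG).
have BaFaG := bounded_momentsM (bounded_moments_avg BF) (bounded_moments_avg BG).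
have S3 := vanishing_momentsMl S1 (bounded_moments_avg BG).
have S4 := vanishing_momentsMr (bounded_moments_cst P m1) S2.
have S5 : vanishing_moments P (fun N _ _ => N.+1%:R^-1 : R).
  by apply: vanishing_moments_cvg0; exact: cvg_harmonic.
have S6 := vanishing_momentsMl S5 (bounded_momentsD BFG (bounded_momentsN BaFaG)).
have := vanishing_momentsD (vanishing_momentsD S12
  (vanishing_momentsN (vanishing_momentsD S3 S4))) S6.
congr vanishing_moments; apply: family_ext => N k w.
by rewrite scov_avg; ring.
Qed.

End sample_covariance.

(** * Positive definite matrices and the gain *)

Section positive_matrices.
Context {R : realType}.

Lemma qformD n (S S' : 'M[R]_n) c : qform (S + S') c = qform S c + qform S' c.
Proof. by rewrite /qform mulmxDr mulmxDl mxE. Qed.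

Lemma qform_congr n p (Q : 'M[R]_n) (H : 'M[R]_(p, n)) c :
  qform (H *m Q *m H^T) c = qform Q (H^T *m c).
Proof. by rewrite /qform trmx_mul trmxK !mulmxA. Qed.

Lemma qformE n (S : 'M[R]_n) c :
  qform S c = \sum_i \sum_j c i ord0 * S i j * c j ord0.
Proof.
rewrite /qform mxE exchange_big/=; apply: eq_bigr => j _.
by rewrite mxE mulr_suml; apply: eq_bigr => i _; rewrite mxE.
Qed.

(** These test vectors read off entries: [e = 1] and [e = -1] bound an off-diagonal entry by
    diagonal ones, and [e = 0] returns a diagonal entry. *)
Lemma qform_delta2 n (S : 'M[R]_n) i j (e : R) : S^T = S ->
  qform S (delta_mx i ord0 + e *: delta_mx j ord0) =
  S i i + 2 * e * S i j + e ^+ 2 * S j j.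
Proof.
move=> symS.
have SE k l : ((delta_mx k ord0 : 'cV[R]_n)^T *m S *m (delta_mx l ord0 : 'cV[R]_n))
    ord0 ord0 = S k l.
  by rewrite trmx_delta -rowE -colE !mxE.
have Sji : S j i = S i j by rewrite -{1}symS mxE.
rewrite /qform [(_ + _)^T]linearD/= [(_ *: _)^T]linearZ/= !mulmxDr !mulmxDl.
rewrite -!(scalemxAl, scalemxAr).
have addE (M M' : 'M[R]_1) : (M + M') ord0 ord0 = M ord0 ord0 + M' ord0 ord0.
  by rewrite mxE.
have scaleE a (M : 'M[R]_1) : (a *: M) ord0 ord0 = a * M ord0 ord0 by rewrite mxE.
rewrite !(addE, scaleE) !SE Sji; ring.
Qed.

Lemma sym_possemidef_entry n (S : 'M[R]_n) i j : sym_possemidef S ->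
  `|S i j| <= (S i i + S j j) / 2.
Proof.
move=> [symS S0].
have := S0 (delta_mx i ord0 + 1 *: delta_mx j ord0).
have := S0 (delta_mx i ord0 + (-1) *: delta_mx j ord0).
by rewrite !qform_delta2// ler_norml => ? ?; apply/andP; split; lra.
Qed.

Lemma sym_posdef_unitmx n (S : 'M[R]_n) : sym_posdef S -> S \in unitmx.
Proof.
move=> [symS S0]; rewrite -row_free_unit -kermx_eq0.
apply/eqP/row_matrixP => i; rewrite row0; apply/eqP/negPn/negP => v0.
have /sub_kermxP vS : (row i (kermx S) <= kermx S)%MS := row_sub _ _.
have /S0 : (row i (kermx S))^T != 0 by rewrite trmx_eq0.
by rewrite /qform trmxK vS mul0mx mxE ltxx.
Qed.

Lemma sym_posdef_congrD n p (Q : 'M[R]_n) (H : 'M[R]_(p, n)) V :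
  sym_possemidef Q -> sym_posdef V -> sym_posdef (H *m Q *m H^T + V).
Proof.
move=> [symQ Q0] [symV V0]; split=> [|c c0].
  by rewrite linearD/= !trmx_mul trmxK symQ symV mulmxA.
by rewrite qformD ltr_wpDl// ?V0// qform_congr.
Qed.

Lemma trmx_inv_sym n (S : 'M[R]_n) : S^T = S -> (invmx S)^T = invmx S.
Proof. by move=> symS; rewrite trmx_inv symS. Qed.

Lemma qform_invmx n (S : 'M[R]_n) c : sym_posdef S ->
  qform (invmx S) c = qform S (invmx S *m c).
Proof.
move=> pS; have [symS _] := pS; have uS := sym_posdef_unitmx pS.
by rewrite /qform trmx_mul trmx_inv_sym// !mulmxA mulmxKV.
Qed.

Lemma sym_possemidef_invmx n (S : 'M[R]_n) :
  sym_posdef S -> sym_possemidef (invmx S).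
Proof.
move=> pS; have [symS S0] := pS; split; first exact: trmx_inv_sym.
move=> c; rewrite qform_invmx//.
have [->|/S0/ltW//] := eqVneq (invmx S *m c) 0.
by rewrite /qform mulmx0 mxE.
Qed.

(* The inverse is antitone: expand [0 <= qform V (x - y)] with [x = S^-1 c] and
   [y = V^-1 c]. *)
Lemma qform_invmx_le n (S V : 'M[R]_n) c : sym_posdef S -> sym_posdef V ->
  (forall c, qform V c <= qform S c) -> qform (invmx S) c <= qform (invmx V) c.
Proof.
move=> pS pV le_VS; have [symV V0] := pV.
set x := invmx S *m c; set y := invmx V *m c.
have Vxy : 0 <= qform V (x - y).
  have [->|/V0/ltW//] := eqVneq (x - y) 0.
  by rewrite /qform mulmx0 mxE.
have Vy : V *m y = c by rewrite mulKVmx// sym_posdef_unitmx.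
have yV : y^T *m V = c^T by rewrite -{1}symV -trmx_mul Vy.
have Vexp : qform V (x - y) =
    qform V x - 2 * (c^T *m x) ord0 ord0 + (c^T *m y) ord0 ord0.
  have xc : (x^T *m c) ord0 ord0 = (c^T *m x) ord0 ord0.
    by rewrite !mxE; apply: eq_bigr => k _; rewrite !mxE mulrC.
  have subE (M M' : 'M[R]_1) : (M - M') ord0 ord0 = M ord0 ord0 - M' ord0 ord0.
    by rewrite !mxE.
  rewrite /qform [(_ - _)^T]linearB/= !mulmxBl !mulmxBr yV -(mulmxA _ V y) Vy.
  by rewrite !subE xc; ring.
have -> : qform (invmx V) c = (c^T *m y) ord0 ord0 by rewrite /qform mulmxA.
have Sx : qform (invmx S) c = (c^T *m x) ord0 ord0 by rewrite /qform mulmxA.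
have := le_VS x; rewrite -qform_invmx// Sx.
by move: Vxy; rewrite Vexp; lra.
Qed.

(** The bound is free of [Q]: positivity reduces any entry to diagonal ones, and antitonicity of the
    inverse compares these with the diagonal of [invmx V]. *)
Lemma invmx_entry_bound n p (Q : 'M[R]_n) (H : 'M[R]_(p, n)) V i j :
  sym_possemidef Q -> sym_posdef V ->
  `|invmx (H *m Q *m H^T + V) i j| <= (invmx V i i + invmx V j j) / 2.
Proof.
move=> pQ pV; have pS := sym_posdef_congrD H pQ pV.
apply: (le_trans (sym_possemidef_entry i j (sym_possemidef_invmx pS))).
have diag k : invmx (H *m Q *m H^T + V) k k <= invmx V k k.
  have qE (M : 'M[R]_p) : M^T = M -> qform M (delta_mx k ord0 + 0 *: delta_mx k ord0) = M k k.
    by move=> symM; rewrite qform_delta2//; ring.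
  rewrite -!qE; try (by apply: trmx_inv_sym; case: pV); last first.
    by apply: trmx_inv_sym; case: pS.
  apply: qform_invmx_le => // c; rewrite qformD lerDr qform_congr.
  by case: pQ => _; apply.
by rewrite ler_pM2r ?invr_gt0// lerD.
Qed.

(** Resolvent identity [S'^-1 - S^-1 = S'^-1 (S - S') S^-1]. It is arranged so that, apart from the
    difference, [Q] occurs only inside an inverse; with [Q'] fixed, all coefficients are then
    bounded. *)
Lemma gain_sub n p (Q Q' : 'M[R]_n) (H : 'M[R]_(p, n)) V :
  sym_possemidef Q -> sym_possemidef Q' -> sym_posdef V ->
  gain Q H V - gain Q' H V =
  (Q - Q') *m (H^T *m invmx (H *m Q *m H^T + V)) -
  Q' *m (H^T *m invmx (H *m Q' *m H^T + V) *m H) *m (Q - Q') *m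
    (H^T *m invmx (H *m Q *m H^T + V)).
Proof.
move=> pQ pQ' pV.
have uS := sym_posdef_unitmx (sym_posdef_congrD H pQ pV).
have uS' := sym_posdef_unitmx (sym_posdef_congrD H pQ' pV).
rewrite /gain; move: uS uS'.
set S := _ + V; set S' := H *m Q' *m _ + V => uS uS'.
have inv_sub : invmx S' - invmx S = invmx S' *m (H *m (Q - Q') *m H^T) *m invmx S.
  have -> : H *m (Q - Q') *m H^T = S - S'.
    by rewrite mulmxBr mulmxBl /S /S' opprD addrACA subrr addr0.
  by rewrite mulmxBr mulmxBl mulVmx// mul1mx -mulmxA mulmxV// mulmx1.
have -> : Q' *m (H^T *m invmx S' *m H) *m (Q - Q') *m (H^T *m invmx S) =
    Q' *m H^T *m (invmx S' - invmx S) by rewrite inv_sub !mulmxA.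
rewrite mulmxBr mulmxBl !mulmxA.
by rewrite opprB addrA subrK.
Qed.

Lemma sample_cov_possemidef n N (x : 'I_N.+2 -> 'cV[R]_n) :
  sym_possemidef (sample_cov x).
Proof.
split=> [|c].
  rewrite /sample_cov linearZ/= linear_sum/=; congr (_ *: _).
  by apply: eq_bigr => k _; rewrite trmx_mul trmxK.
rewrite /qform /sample_cov -scalemxAr -scalemxAl mxE mulr_ge0//.
rewrite mulmx_sumr mulmx_suml summxE sumr_ge0// => k _.
set v := x k - _; rewrite mulmxA -(mulmxA _ _ c).
have -> : c^T *m v = (v^T *m c)^T by rewrite trmx_mul trmxK.
by rewrite mxE big_ord1 mxE -expr2 sqr_ge0.
Qed.

End positive_matrices.

(** * Gaussian moments *)

Section density.
Import HBNNSimple.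

(** The left side is a supremum over simple functions below [f], and for a simple function the
    density formula is a finite sum. *)
Lemma density_integral_le (R : realType) d (T : measurableType d) (mu nu : {measure set T -> \bar R})
    (g : T -> R) (f : T -> R) :
  measurable_fun setT g -> (forall x, 0 <= g x) ->
  measurable_fun setT f -> (forall x, 0 <= f x) ->
  (forall B, measurable B -> nu B = \int[mu]_(x in B) (g x)%:E)%E ->
  (\int[nu]_x (f x)%:E <= \int[mu]_x (f x * g x)%:E)%E.
Proof.
move=> mg g0 mf f0 nuE.
rewrite ge0_integralTE//.
apply: ge_ereal_sup => _ [h hf <-].
rewrite sintegralE.
have mh x : measurable (h @^-1` [set x]).
  by rewrite -[X in measurable X]setTI; exact: (measurable_funPT h).
(* [|x|] equals [x] on the range of the nonnegative [h] and keeps the summand nonnegative for every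
   [x], as exchanging sum and integral requires. *)
have mI x : measurable_fun setT (fun y : T => (`|x| * \1_(h @^-1` [set x]) y * g y)%:E).
  apply/measurable_EFinP; apply: measurable_funM => //.
  by apply: measurable_funM => //; exact: measurable_indic.
have h0 x : x \in fset_set (range h) -> `|x| = x.
  by rewrite in_fset_set// inE => -[y _ <-]; rewrite ger0_norm.
have hE : (\sum_(x \in range h) x%:E * nu (h @^-1` [set x]))%E =
    (\int[mu]_y (h y * g y)%:E)%E.
  rewrite (eq_integral (fun y => \sum_(x <- fset_set (range h))
      (`|x| * \1_(h @^-1` [set x]) y * g y)%:E)%E); last first.
    move=> y _; rewrite sumEFin; congr EFin.
    rewrite [X in X * _]fimfunE fsbig_finite//= mulr_suml.
    by rewrite big_seq [RHS]big_seq; apply: eq_bigr => x /h0 ->.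
  rewrite fsbig_finite//= ge0_integral_sum//; last first.
    by move=> x y _; rewrite lee_fin !mulr_ge0.
  rewrite big_seq [RHS]big_seq; apply: eq_bigr => x /h0 xx.
  rewrite -{1}xx; under eq_integral do rewrite -mulrA EFinM.
  rewrite ge0_integralZl_EFin//; last 2 first.
  - by move=> y _; rewrite lee_fin mulr_ge0.
  - by apply/measurable_EFinP; apply: measurable_funM.
  congr (_ * _)%E; rewrite nuE// integral_mkcond.
  apply: eq_integral => y _; rewrite patchE indicE.
  by case: ifP => _; rewrite ?mul1r ?mul0r.
rewrite hE; apply: ge0_le_integral => //.
- by move=> x _; rewrite lee_fin mulr_ge0.
- by apply/measurable_EFinP; apply: measurable_funM.
- by apply/measurable_EFinP; apply: measurable_funM.
- by move=> x _; rewrite lee_fin ler_wpM2r//; have := hf x; rewrite lee_fin.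
Qed.

End density.

Section gaussian_moments.
Context {R : realType}.

Lemma exprn_le_fact_expR (u : R) r : 0 <= u -> u ^+ r <= r`!%:R * expR u.
Proof.
move=> u0; case: r => [|r].
  by rewrite expr0 mul1r (le_trans _ (expR_ge1Dx u))// lerDl.
rewrite -ler_pdivrMl ?ltr0n ?fact_gt0// mulrC.
by apply: le_trans (expR_ge1Dxn r u0); rewrite lerDr.
Qed.

(* A gaussian density absorbs a polynomial factor at the cost of doubling the
   standard deviation. *)
Lemma normal_fun_moment_bound (m s : R) r : s != 0 ->
  exists2 C, 0 <= C & forall x,
    `|x| ^+ r * normal_fun m s x <= C * normal_fun m (2 * s) x.
Proof.
move=> s0; have s2 : 0 < s ^+ 2 by rewrite exprn_even_gt0.
(* The exponents at deviations [s] and [2 * s] differ by [(1/2 - 1/8) (x - m)^2 / s^2], which is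
   [(x - m)^2 / a]. *)
pose a := 8 / 3 * s ^+ 2; have a0 : 0 < a by rewrite mulr_gt0 ?divr_gt0.
exists (2 ^+ r * (1 + a ^+ r * r`!%:R) + 2 ^+ r * `|m| ^+ r).
  rewrite addr_ge0// mulr_ge0 ?exprn_ge0//.
  by rewrite addr_ge0// mulr_ge0// exprn_ge0// ltW.
move=> x; set u := (x - m) ^+ 2 / a.
have u0 : 0 <= u by rewrite divr_ge0 ?sqr_ge0// ltW.
have -> : normal_fun m s x = expR (- u) * normal_fun m (2 * s) x.
  rewrite /normal_fun -expRD; congr expR; rewrite /u /a.
  by field.
rewrite mulrA ler_wpM2r ?expR_ge0// expRN ler_pdivrMr ?expR_gt0//.
have e1 : 1 <= expR u by rewrite (le_trans _ (expR_ge1Dx u))// lerDl.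
have -> : x = (x - m) + m by rewrite subrK.
apply: (le_trans (ler_normD_exp _ _ _)); rewrite mulrDl.
apply: lerD; last by rewrite ler_peMr// mulr_ge0 ?exprn_ge0.
rewrite -mulrA ler_wpM2l ?exprn_ge0//.
(* [|z| <= 1 + z^2] makes the power even, hence a power of [u], which [expR u] dominates. *)
apply: (@le_trans _ _ (1 + ((x - m) ^+ 2) ^+ r)).
  rewrite exprAC -normrX; set z := _ ^+ r; rewrite -(real_normK (num_real z)).
  have := sqr_ge0 (2 * `|z| - 1); nra.
rewrite mulrDl mul1r lerD// -(divfK (lt0r_neq0 a0) ((x - m) ^+ 2)) -/u.
rewrite exprMn [leLHS]mulrC -mulrA ler_wpM2l//; first by rewrite exprn_ge0// ltW.
exact: exprn_le_fact_expR.
Qed.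

Lemma normal_prob_moment (m s : R) r : s != 0 ->
  exists C : R, (\int[normal_prob m s]_x (`|x| ^+ r)%:E <= C%:E)%E.
Proof.
move=> s0; have [C C0 le_C] := normal_fun_moment_bound m r s0.
have s20 : 2 * s != 0 by rewrite mulf_neq0.
(* The ratio of peaks turns the bound on unnormalised functions into one on densities; the wider
   density has mass 1. *)
exists (C * normal_peak s / normal_peak (2 * s)).
have mr : measurable_fun setT (fun x : R => `|x| ^+ r) by exact: measurable_funX.
apply: le_trans.
  apply: (@density_integral_le _ _ _ lebesgue_measure _ (normal_pdf m s)) => //.
    exact: measurable_normal_pdf.
  by move=> x; exact: normal_pdf_ge0.
apply: (@le_trans _ _ (\int[lebesgue_measure]_x
    ((C * normal_peak s / normal_peak (2 * s))%:E * (normal_pdf m (2 * s) x)%:E))%E).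
  apply: ge0_le_integral => //.
  - by move=> x _; rewrite lee_fin mulr_ge0 ?exprn_ge0 ?normal_pdf_ge0.
  - apply/measurable_EFinP; apply: measurable_funM => //.
    exact: measurable_normal_pdf.
  - apply: measurable_funeM; apply/measurable_EFinP.
    exact: measurable_normal_pdf.
  - move=> x _; rewrite -EFinM lee_fin !normal_pdfE//.
    rewrite mulrCA -[leRHS]mulrA mulKf ?gt_eqF ?normal_peak_gt0//.
    rewrite [leRHS]mulrAC [leRHS]mulrC ler_wpM2l ?normal_peak_ge0//.
rewrite ge0_integralZl_EFin//.
- by rewrite integral_normal_pdf mule1.
- by move=> x _; rewrite lee_fin normal_pdf_ge0.
- by apply/measurable_EFinP; exact: measurable_normal_pdf.
- by rewrite !mulr_ge0 ?invr_ge0 ?normal_peak_ge0.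
Qed.

Context {d : measure_display} {T : measurableType d}.
Variable P : probability T R.

(** [C] is chosen before [X], hence shared by all variables of the same law: uniformity over the
    members originates here. *)
Lemma normal_law_moment (m v : R) r : 0 <= v -> exists C : R, forall X : T -> R,
  measurable_fun setT X ->
  (forall B, measurable B -> P (X @^-1` B) = normal_law m v B) ->
  (moment P r X <= C%:E)%E.
Proof.
move=> v_ge0; have mr : measurable_fun setT (fun x : R => (`|x| ^+ r)%:E).
  by apply/measurable_EFinP; exact: measurable_funX.
(* [normal_prob] is a measure on [measurableTypeR R], the reals with a display of
   their own. *)
have reduce (nu : {measure set (measurableTypeR R) -> \bar R}) (X : T -> R) : measurable_fun setT X ->
    (forall B, measurable B -> P (X @^-1` B) = nu B) ->
    moment P r X = (\int[nu]_x (`|x| ^+ r)%:E)%E.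
  move=> mX law.
  have mX' : measurable_fun setT (X : T -> measurableTypeR R) := mX.
  pose X' : {mfun T >-> measurableTypeR R} :=
    HB.pack (X : T -> measurableTypeR R) (isMeasurableFun.Build _ _ _ _ _ mX').
  transitivity (\int[distribution P X']_x (`|x| ^+ r)%:E)%E.
    by rewrite ge0_integral_distribution// => x; rewrite lee_fin exprn_ge0.
  by apply: eq_measure_integral => B mB _; rewrite -law.
rewrite /normal_law; case: eqP => [_|/eqP v0].
  exists (`|m| ^+ r) => X mX law.
  rewrite (reduce (\d_(m : measurableTypeR R)) _ mX law).
  by rewrite integral_dirac// diracT mul1e.
have [|C CP] := @normal_prob_moment m (Num.sqrt v) r.
  by rewrite gt_eqF// sqrtr_gt0 lt_neqAle eq_sym v0.
exists C => X mX law.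
by rewrite (reduce (normal_prob m (Num.sqrt v)) _ mX law).
Qed.

Lemma has_normal_law_moment n (mu : 'cV[R]_n) (S : 'M[R]_n) i r :
  exists C : R, forall X : {RV P >-> 'cV[R]_n}, has_normal_law X mu S ->
  (moment P r (fun w => X w i ord0) <= C%:E)%E.
Proof.
pose c : 'cV[R]_n := delta_mx i ord0.
(* [S] is arbitrary when the constant is chosen; if the variance would be negative, no vector has
   this law. *)
have [v0|v0] := leP 0 (qform S c); last first.
  by exists 0 => X [[_ /(_ c)]]; rewrite leNgt v0.
have [C CP] := normal_law_moment ((c^T *m mu) ord0 ord0) r v0.
exists C => X [_ law]; apply: CP.
  by apply: measurable_mx_entry; exact: measurable_funPT.
move=> B mB; rewrite -(law c B mB).
rewrite (_ : (fun w => X w i ord0) = (fun w => (c^T *m X w) ord0 ord0))//.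
by apply/funext => w; rewrite trmx_delta -rowE mxE.
Qed.

End gaussian_moments.

(** * Moment calculus for matrices *)

Section matrix_families.
Context {R : realType} {d : measure_display} {T : measurableType d}.
Variable P : probability T R.

Definition mx_family m n := forall N : nat, 'I_N.+2 -> T -> 'M[R]_(m, n).

Definition mx_bounded m n (M : mx_family m n) :=
  forall i j, bounded_moments P (fun N k w => M N k w i j).

Definition mx_vanishing m n (M : mx_family m n) :=
  forall i j, vanishing_moments P (fun N k w => M N k w i j).

Lemma mx_boundedE m n (M M' : mx_family m n) :
  (forall N k w, M N k w = M' N k w) -> mx_bounded M -> mx_bounded M'.
Proof.
move=> MM' BM i j; have := BM i j.
by congr bounded_moments; apply: family_ext => N k w; rewrite MM'.
Qed.

Lemma mx_vanishingE m n (M M' : mx_family m n) :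
  (forall N k w, M N k w = M' N k w) -> mx_vanishing M -> mx_vanishing M'.
Proof.
move=> MM' BM i j; have := BM i j.
by congr vanishing_moments; apply: family_ext => N k w; rewrite MM'.
Qed.

Lemma mx_vanishing_bounded m n (M : mx_family m n) :
  mx_vanishing M -> mx_bounded M.
Proof. by move=> SM i j; exact: vanishing_bounded. Qed.

Lemma mx_bounded_cst m n (C : 'M[R]_(m, n)) : mx_bounded (fun _ _ _ => C).
Proof. by move=> i j; exact: bounded_moments_cst. Qed.

Lemma mx_boundedD m n (M M' : mx_family m n) : mx_bounded M -> mx_bounded M' ->
  mx_bounded (fun N k w => M N k w + M' N k w).
Proof.
move=> BM BM' i j; have := bounded_momentsD (BM i j) (BM' i j).
by congr bounded_moments; apply: family_ext => N k w; rewrite mxE.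
Qed.

Lemma mx_vanishingD m n (M M' : mx_family m n) : mx_vanishing M -> mx_vanishing M' ->
  mx_vanishing (fun N k w => M N k w + M' N k w).
Proof.
move=> BM BM' i j; have := vanishing_momentsD (BM i j) (BM' i j).
by congr vanishing_moments; apply: family_ext => N k w; rewrite mxE.
Qed.

Lemma mx_boundedN m n (M : mx_family m n) : mx_bounded M ->
  mx_bounded (fun N k w => - M N k w).
Proof.
move=> BM i j; have := bounded_momentsN (BM i j).
by congr bounded_moments; apply: family_ext => N k w; rewrite mxE.
Qed.

Lemma mx_vanishingN m n (M : mx_family m n) : mx_vanishing M ->
  mx_vanishing (fun N k w => - M N k w).
Proof.
move=> BM i j; have := vanishing_momentsN (BM i j).
by congr vanishing_moments; apply: family_ext => N k w; rewrite mxE.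
Qed.

Lemma mx_boundedM m n p (M : mx_family m n) (M' : mx_family n p) :
  mx_bounded M -> mx_bounded M' -> mx_bounded (fun N k w => M N k w *m M' N k w).
Proof.
move=> BM BM' i j.
have := bounded_moments_sum (index_enum 'I_n)
  (fun l => bounded_momentsM (BM i l) (BM' l j)).
by congr bounded_moments; apply: family_ext => N k w; rewrite mxE.
Qed.

Lemma mx_vanishingMl m n p (M : mx_family m n) (M' : mx_family n p) :
  mx_vanishing M -> mx_bounded M' -> mx_vanishing (fun N k w => M N k w *m M' N k w).
Proof.
move=> BM BM' i j.
have := vanishing_moments_sum (index_enum 'I_n)
  (fun l => vanishing_momentsMl (BM i l) (BM' l j)).
by congr vanishing_moments; apply: family_ext => N k w; rewrite mxE.
Qed.

Lemma mx_vanishingMr m n p (M : mx_family m n) (M' : mx_family n p) :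
  mx_bounded M -> mx_vanishing M' -> mx_vanishing (fun N k w => M N k w *m M' N k w).
Proof.
move=> BM BM' i j.
have := vanishing_moments_sum (index_enum 'I_n)
  (fun l => vanishing_momentsMr (BM i l) (BM' l j)).
by congr vanishing_moments; apply: family_ext => N k w; rewrite mxE.
Qed.

Lemma mx_bounded_invmx n p (Q : mx_family n n) (H : 'M[R]_(p, n)) (V : 'M[R]_p) :
  sym_posdef V -> (forall N k w, sym_possemidef (Q N k w)) ->
  (forall N k, measurable_fun setT (Q N k)) ->
  mx_bounded (fun N k w => invmx (H *m Q N k w *m H^T + V)).
Proof.
move=> pV pQ mQ i j.
apply: (bounded_moments_le (bounded_moments_cst P ((invmx V i i + invmx V j j) / 2))).
  move=> N k; apply: measurable_mx_entry; apply: measurable_invmx.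
  apply: measurable_addmx => //.
  by apply: measurable_mulmx => //; exact: measurable_mulmx.
move=> N k w; apply: le_trans (ler_norm _).
exact: invmx_entry_bound.
Qed.

Lemma mx_vanishing_gain n p (Q : mx_family n n) (Q0 : 'M[R]_n) (H : 'M[R]_(p, n))
    (V : 'M[R]_p) :
  sym_posdef V -> (forall N k w, sym_possemidef (Q N k w)) -> sym_possemidef Q0 ->
  (forall N k, measurable_fun setT (Q N k)) ->
  mx_vanishing (fun N k w => Q N k w - Q0) ->
  mx_vanishing (fun N k w => gain (Q N k w) H V - gain Q0 H V).
Proof.
move=> pV pQ pQ0 mQ SQ.
have BI := mx_boundedM (mx_bounded_cst H^T) (mx_bounded_invmx H pV pQ mQ).
have S1 := mx_vanishingMl SQ BI.
have S2 := mx_vanishingMl (mx_vanishingMr (mx_bounded_cst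
  (Q0 *m (H^T *m invmx (H *m Q0 *m H^T + V) *m H))) SQ) BI.
apply: mx_vanishingE (mx_vanishingD S1 (mx_vanishingN S2)) => N k w.
by rewrite gain_sub// mulmxA.
Qed.

End matrix_families.

(** * Exact covariance matrices *)

Section covariance_matrix.
Context {R : realType} {d : measure_display} {T : measurableType d}.
Variable P : probability T R.

Lemma bounded_moments_fun_integrable (f : T -> R) :
  bounded_moments P (fun N (_ : 'I_N.+2) => f) -> f \in Lfun P 1.
Proof. by move=> Bf; apply/Lfun1_integrable; exact: bounded_moments_term_integrable. Qed.

(** The form at [c] is the integral of the square of the centred functional. Moment bounds make the
    covariances finite, so [fine] does not alter them. *)
Lemma cov_mx_possemidef n (X : T -> 'cV[R]_n) :
  mx_bounded P (fun N (_ : 'I_N.+2) => X) -> sym_possemidef (cov_mx P X).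
Proof.
move=> BX; split=> [|c].
  by apply/matrixP => i j; rewrite !mxE covarianceC.
pose a i w := X w i ord0 - fine 'E_P[fun w => X w i ord0]%E.
have Ba i : bounded_moments P (fun N (_ : 'I_N.+2) => a i).
  exact: (bounded_momentsD (BX i ord0) (bounded_moments_cst P _)).
have Iaa i j : P.-integrable setT (fun w => (a i w * a j w)%:E).
  apply: bounded_moments_term_integrable.
  exact: bounded_momentsM (Ba i) (Ba j).
rewrite qformE -lee_fin -sumEFin.
rewrite (_ : (\sum_i _)%E =
    (\int[P]_w ((\sum_i c i ord0 * a i w) ^+ 2)%:E)%E).
  by apply: integral_ge0 => w _; rewrite lee_fin sqr_ge0.
under [RHS]eq_integral => w _.
  rewrite expr2 mulr_suml.
  under eq_bigr do rewrite mulr_sumr.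
  rewrite pair_big/= -sumEFin.
  under eq_bigr do rewrite mulrACA EFinM.
  over.
rewrite integral_sum//; last by move=> -[i j]; apply: integrableZl.
rewrite -(pair_big xpredT xpredT (fun i j =>
  \int[P]_w ((c i ord0 * c j ord0)%:E * (a i w * a j w)%:E))%E)/=.
apply: eq_bigr => i _; rewrite -sumEFin; apply: eq_bigr => j _.
rewrite integralZl// mulrAC EFinM; congr (_ * _)%E.
have covE : covariance P (fun w => X w i ord0) (fun w => X w j ord0) =
    (\int[P]_w (a i w * a j w)%:E)%E.
  by rewrite covariance.unlock /a expectation.unlock.
by rewrite mxE covE fineK// integrable_fin_num.
Qed.

Lemma cov_mxE n (X : T -> 'cV[R]_n) i j :
  mx_bounded P (fun N (_ : 'I_N.+2) => X) ->
  cov_mx P X i j =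
  fine (\int[P]_w (X w i ord0 * X w j ord0)%:E) -
  fine (\int[P]_w (X w i ord0)%:E) * fine (\int[P]_w (X w j ord0)%:E).
Proof.
move=> BX; rewrite mxE.
have L1 k : (fun w => X w k ord0) \in Lfun P 1.
  exact: bounded_moments_fun_integrable.
have L2 : ((fun w => X w i ord0) * (fun w => X w j ord0)) \in Lfun P 1.
  apply: bounded_moments_fun_integrable.
  exact: bounded_momentsM (BX i ord0) (BX j ord0).
rewrite covarianceE// fineB ?fineM ?fin_numM ?expectation_fin_num//.
by rewrite unlock.
Qed.

End covariance_matrix.

(** * Convergence of the ensembles *)

Section convergence.
Context {R : realType} {d : measure_display} {T : measurableType d}.
Variables (P : probability T R) (n : nat) (q : nat -> nat).
Variables (A : nat -> 'M[R]_n) (b : nat -> 'cV[R]_n).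
Variables (H : forall m, 'M[R]_(q m, n)) (dat : forall m, 'cV[R]_(q m)).
Variables (V : forall m, 'M[R]_(q m)).
Variables (U0 : nat -> {RV P >-> 'cV[R]_n}).
Variables (D : forall m : nat, nat -> {RV P >-> 'cV[R]_(q m)}).
Hypothesis posdefV : forall m, (1 <= m)%N -> sym_posdef (V m).
Hypothesis iidU0 : iid U0.
Hypothesis gaussianU0 : forall k, gaussian (U0 k).
Hypothesis iidD : forall m, (1 <= m)%N -> iid (D m).
Hypothesis lawD : forall m k, (1 <= m)%N -> has_normal_law (D m k) (dat m) (V m).
Hypothesis indUD : mutually_independent P
  (fun m : nat => if m is 0%N then sigma_seq U0 else sigma_seq (D m)).

Local Notation U := (reference P A b H V U0 D).
Local Notation Ua := (reference_analysis P A b H V U0 D).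
Local Notation X := (enkf A b H V U0 D).
Local Notation Xa := (enkf_analysis A b H V U0 D).
Local Notation K := (reference_gain A b H V P U0 D).

Lemma measurable_enkf_member N m (k : 'I_N) : measurable_fun setT (X N m k).
Proof. by apply: measurable_enkf => *; exact: measurable_funPT. Qed.

Lemma bounded_U0 : mx_bounded P (fun N (k : 'I_N.+2) => U0 k).
Proof.
move=> i j; rewrite (ord1 j); split=> [N k|r].
  by apply: measurable_mx_entry; exact: measurable_funPT.
(* [gaussian] gives each member parameters of its own; those of member 0 are carried to all members
   by equality in law, so one constant serves them all. *)
have [mu [S [psdS lawU]]] := gaussianU0 0.
have [C CP] := has_normal_law_moment P mu S i r.
exists C, 0%N => N k _; apply: CP; split => // c B mB.
rewrite -(lawU c B mB).
have [_ same] := iidU0.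
have mc : measurable_fun setT (fun v : 'cV[R]_n => (c^T *m v) ord0 ord0).
  by apply: measurable_mx_entry; apply: measurable_mulmx => //; exact: measurable_id.
have := same k 0%N _ (mc measurableT B mB); rewrite setTI.
by [].
Qed.

Lemma bounded_D m : (1 <= m)%N -> mx_bounded P (fun N (k : 'I_N.+2) => D m k).
Proof.
move=> m1 i j; rewrite (ord1 j); split=> [N k|r].
  by apply: measurable_mx_entry; exact: measurable_funPT.
have [C CP] := has_normal_law_moment P (dat m) (V m) i r.
by exists C, 0%N => N k _; apply: CP; exact: lawD.
Qed.

Lemma bounded_forecast m (Z : mx_family n 1) :
  mx_bounded P Z -> mx_bounded P (fun N k w => A m *m Z N k w + b m).
Proof.
move=> BZ; apply: mx_boundedD; last exact: mx_bounded_cst.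
by apply: mx_boundedM => //; exact: mx_bounded_cst.
Qed.

Lemma bounded_reference_analysis m : mx_bounded P (fun N (k : 'I_N.+2) => Ua m k).
Proof.
elim: m => [|m IH]; first exact: bounded_U0.
have BU := bounded_forecast m.+1 IH.
apply: mx_boundedD => //; apply: mx_boundedM; first exact: mx_bounded_cst.
apply: mx_boundedD; first exact: bounded_D.
apply: mx_boundedN; apply: mx_boundedM => //; exact: mx_bounded_cst.
Qed.

Lemma bounded_reference m : mx_bounded P (fun N (k : 'I_N.+2) => U m k).
Proof.
case: m => [|m]; first exact: bounded_U0.
exact: bounded_forecast (bounded_reference_analysis m).
Qed.

Local Notation dpath := (driving_path (driving U0 D)).

Let pathU m k (x : path R (driving_dim n q)) : 'cV[R]_n :=
  gained A b H K (@path_initial R n q) (@path_data R n q) m k x.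

Let pathUE m k w : U m k w = pathU m k (dpath w).
Proof. by rewrite reference_gained; exact: gained_transport. Qed.

Let measurable_pathU m k : measurable_fun setT (pathU m k).
Proof.
apply: measurable_gained => [l|j l]; first exact: measurable_path_initial.
exact: measurable_path_data.
Qed.

Lemma integral_reference_same (phi : 'cV[R]_n -> R) m k :
  measurable_fun setT phi ->
  (\int[P]_w (phi (U m k w))%:E = \int[P]_w (phi (U m 0%N w))%:E)%E.
Proof.
move=> mphi.
(* The transposition of 0 and [k]. *)
pose s (l : nat) := if l == k then 0%N else if l == 0%N then k else l.
have sK : cancel s s.
  move=> l; rewrite /s; case: (eqVneq l k) => [->|lk].
    by case: eqVneq => [->//|_]; rewrite eqxx.
  case: (eqVneq l 0%N) => [->|l0]; first by rewrite eqxx.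
  by rewrite (negbTE lk) (negbTE l0).
have mU l := measurableT_comp mphi (@measurable_pathU m l).
under eq_integral do rewrite pathUE.
under [RHS]eq_integral do rewrite pathUE.
have mE : measurable_fun setT (fun x => (phi (pathU m 0%N x))%:E).
  by apply/measurable_EFinP; exact: mU.
rewrite (integral_path_law (P2 := P) (f2 := fun w j l => driving U0 D j (s l) w)
  _ _ _ mE); last 3 first.
- exact: measurable_driving_path.
- by apply: measurable_path => j l; exact: measurable_funPT.
- move=> M B MB; have := driving_path_shuffle (iid_driving iidU0 iidD)
    (independent_driving indUD) sK; apply.
  by apply: sub_sigma_algebra; exists B => //; exists M.
apply: eq_integral => w _; congr (phi _)%:E.
by apply: gained_transport => [|j]; rewrite /path_initial /path_data /s;
  case: eqVneq => // <-.
Qed.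

Lemma reference_uncorrelated (phi : 'cV[R]_n -> R) m k l :
  measurable_fun setT phi -> k != l ->
  (forall k, P.-integrable setT (fun w => (phi (U m k w))%:E)) ->
  (\int[P]_w (phi (U m k w) * phi (U m l w))%:E =
   (\int[P]_w (phi (U m k w))%:E) * (\int[P]_w (phi (U m l w))%:E))%E.
Proof.
move=> mphi kl iphi.
have mU j := measurableT_comp mphi (@measurable_pathU m j).
have iU j : P.-integrable setT (EFin \o (phi \o pathU m j) \o dpath).
  apply: eq_integrable (iphi j) => // w _ /=.
  by rewrite pathUE.
under eq_integral do rewrite !pathUE.
under [X in _ = (X * _)%E]eq_integral do rewrite pathUE.
under [X in _ = (_ * X)%E]eq_integral do rewrite pathUE.
apply: (driving_path_uncorrelated (iid_driving iidU0 iidD)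
  (independent_driving indUD) (k0 := k) (mU k) (mU l) (iU k) (iU l)) => x y;
  congr (phi _); apply: gained_transport => [|j];
  by rewrite /path_initial /path_data /splice ?eqxx// eq_sym (negbTE kl).
Qed.

(** [phi] is general because sample covariances involve coordinates and their products. Centred at
    the common mean, the values at distinct members are uncorrelated with mean 0. *)
Lemma vanishing_avg_reference (phi : 'cV[R]_n -> R) m :
  measurable_fun setT phi ->
  bounded_moments P (fun N (k : 'I_N.+2) w => phi (U m k w)) ->
  vanishing_moments P (fun N _ w => avg (fun (k : 'I_N.+2) w => phi (U m k w)) w -
    fine (\int[P]_w (phi (U m 0%N w))%:E)).
Proof.
move=> mphi Bphi; set mu := fine _.
have iphi k : P.-integrable setT (fun w => (phi (U m k w))%:E).
  apply: bounded_moments_term_integrable.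
  exact: (@bounded_moments_term _ _ _ _ (fun k w => phi (U m k w))).
have muE k : (\int[P]_w (phi (U m k w))%:E)%E = mu%:E.
  by rewrite integral_reference_same// fineK// integrable_fin_num.
pose psi v := phi v - mu.
have mpsi : measurable_fun setT psi by exact: measurable_funB.
have BW : bounded_moments P (fun N (k : 'I_N.+2) w => psi (U m k w)).
  exact: bounded_momentsD Bphi (bounded_moments_cst P _).
have ipsi k : P.-integrable setT (fun w => (psi (U m k w))%:E).
  apply: bounded_moments_term_integrable.
  exact: (@bounded_moments_term _ _ _ _ (fun k w => psi (U m k w))).
have psi0 k : (\int[P]_w (psi (U m k w))%:E = 0)%E.
  under eq_integral do rewrite EFinB.
  rewrite integralB//; last exact: finite_measure_integrable_cst.
  by rewrite muE integral_probability_cst subee.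
have := @vanishing_avg_uncorrelated _ _ _ P (fun k w => psi (U m k w)) BW.
have uncorr k l : k != l ->
    (\int[P]_w (psi (U m k w) * psi (U m l w))%:E = 0)%E.
  by move=> kl; rewrite (@reference_uncorrelated psi)// psi0 mul0e.
move=> /(_ uncorr); congr vanishing_moments; apply: family_ext => N k w.
rewrite avgB; congr (_ - _).
by rewrite /avg sumr_const card_ord -[mu *+ _]mulr_natl mulKf.
Qed.

Lemma sample_cov_scov N (x : 'I_N.+2 -> T -> 'cV[R]_n) w i j :
  sample_cov (x^~ w) i j =
  scov (fun k w => x k w i ord0) (fun k w => x k w j ord0) w.
Proof.
rewrite /sample_cov mxE summxE /scov; congr (_ * _).
apply: eq_bigr => k _; rewrite mxE big_ord1 !mxE.
by rewrite !summxE.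
Qed.

Lemma vanishing_sample_cov m :
  mx_vanishing P (fun N (k : 'I_N.+2) w => X N.+2 m k w - U m k w) ->
  mx_vanishing P (fun N (_ : 'I_N.+2) w =>
    sample_cov (X N.+2 m ^~ w) - cov_mx P (U m 0%N)).
Proof.
move=> SXU i j.
have BU := @bounded_reference m.
have BX : mx_bounded P (fun N (k : 'I_N.+2) => X N.+2 m k).
  apply: mx_boundedE (mx_boundedD (mx_vanishing_bounded SXU) BU) => N k w.
  by rewrite subrK.
have SX l : vanishing_moments P (fun N (k : 'I_N.+2) w =>
    X N.+2 m k w l ord0 - U m k w l ord0).
  have := SXU l ord0.
  by congr vanishing_moments; apply: family_ext => N k w; rewrite !mxE.
have ment l : measurable_fun setT (fun v : 'cV[R]_n => v l ord0).
  by apply: measurable_mx_entry; exact: measurable_id.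
have S1 := vanishing_scovB (BU i ord0) (BX j ord0) (SX i) (SX j).
have S2 := vanishing_scov_lln (BU i ord0) (BU j ord0)
  (vanishing_avg_reference (ment i) (BU i ord0))
  (vanishing_avg_reference (ment j) (BU j ord0))
  (@vanishing_avg_reference (fun v => v i ord0 * v j ord0) m
    (measurable_funM (ment i) (ment j)) (bounded_momentsM (BU i ord0) (BU j ord0))).
have := vanishing_momentsD S1 S2.
congr vanishing_moments; apply: family_ext => N k w.
have BU1 : mx_bounded P (fun N (_ : 'I_N.+2) => U m 0%N).
  by move=> i' j'; exact: (@bounded_moments_term _ _ _ _
    (fun k w => U m k w i' j') 0%N (BU i' j')).
by rewrite mxE [X in _ = _ + X]mxE sample_cov_scov cov_mxE// subrKA.
Qed.

Lemma vanishing_analysis m :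
  mx_vanishing P (fun N (k : 'I_N.+2) w => Xa N.+2 m k w - Ua m k w).
Proof.
elim: m => [|m IH].
  apply: (@mx_vanishingE _ _ _ P _ _ (fun _ _ _ => 0)) => [N k w|i j].
    by rewrite subrr.
  have := vanishing_moments0 P.
  by congr vanishing_moments; apply: family_ext => N k w; rewrite mxE.
have SXU : mx_vanishing P (fun N (k : 'I_N.+2) w => X N.+2 m.+1 k w - U m.+1 k w).
  apply: mx_vanishingE (mx_vanishingMr (mx_bounded_cst P (A m.+1)) IH) => N k w.
  by rewrite /= /forecast mulmxBr opprD addrACA subrr addr0.
have BU := @bounded_reference m.+1.
have mX N k := @measurable_enkf_member N m.+1 k.
have pV := posdefV (isT : (1 <= m.+1)%N).
have pQ N w : sym_possemidef (sample_cov (X N.+2 m.+1 ^~ w)).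
  exact: sample_cov_possemidef.
have pQ0 : sym_possemidef (cov_mx P (U m.+1 0%N)).
  apply: cov_mx_possemidef => i j.
  exact: (@bounded_moments_term _ _ _ _ (fun k w => U m.+1 k w i j) 0%N (BU i j)).
have SK : mx_vanishing P (fun N (_ : 'I_N.+2) w =>
    gain (sample_cov (X N.+2 m.+1 ^~ w)) (H m.+1) (V m.+1) - K m.+1).
  apply: mx_vanishing_gain => //; last exact: vanishing_sample_cov.
  by move=> N _; apply: measurable_sample_cov => k; exact: mX.
(* The random gain has bounded moments as a vanishing family plus the constant reference gain. *)
have BK : mx_bounded P (fun N (_ : 'I_N.+2) w =>
    gain (sample_cov (X N.+2 m.+1 ^~ w)) (H m.+1) (V m.+1)).
  apply: mx_boundedE (mx_boundedD (mx_vanishing_bounded SK) (mx_bounded_cst P (K m.+1))).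
  by move=> N k w; rewrite subrK.
have BDU : mx_bounded P (fun N (k : 'I_N.+2) w =>
    D m.+1 k w - H m.+1 *m U m.+1 k w).
  apply: mx_boundedD; first exact: bounded_D.
  by apply: mx_boundedN; apply: mx_boundedM => //; exact: mx_bounded_cst.
have S1 := mx_vanishingMr BK (mx_vanishingMr (mx_bounded_cst P (H m.+1)) SXU).
have S2 := mx_vanishingMl SK BDU.
apply: mx_vanishingE (mx_vanishingD (mx_vanishingD SXU (mx_vanishingN S1)) S2).
move=> N k w.
rewrite /= /analysis -/(X N.+2 m.+1) -/(U m.+1) -/(K m.+1).
set G := gain (sample_cov _) _ _; set x := X _ _ _ _; set u := U _ _ _.
rewrite /= -/x -/u.
rewrite !(mulmxBr, mulmxBl, mulmxA).
move: (G *m H m.+1 *m x) (G *m H m.+1 *m u) (G *m D m.+1 k w)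
  (K m.+1 *m H m.+1 *m u) (K m.+1 *m D m.+1 k w) => a1 a2 a3 a4 a5.
apply/matrixP => i j; rewrite !mxE; ring.
Qed.

Lemma vanishing_enkf m :
  mx_vanishing P (fun N (k : 'I_N.+2) w => X N.+2 m k w - U m k w).
Proof.
case: m => [|m]; first exact: (vanishing_analysis 0).
apply: mx_vanishingE (mx_vanishingMr (mx_bounded_cst P (A m.+1))
  (vanishing_analysis m)) => N k w.
by rewrite /= /forecast mulmxBr opprD addrACA subrr addr0.
Qed.

End convergence.

(** * From integer moments to the $L^p$ norm *)

Section Lp_convergence.
Context {R : realType} {d : measure_display} {T : measurableType d}.
Variable P : probability T R.

(** The first term dominates when [t <= 1], the second when [t >= 1]; a real exponent is thus
    reduced to two integer moments. *)
Lemma powR_le_add_exp (t p : R) r : 0 <= t -> 1 <= p -> p <= r%:R ->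
  t `^ p <= t + t ^+ r.
Proof.
move=> t0 p1 pr; have [t1|/ltW t1] := leP t 1.
  apply: ler_wpDr; first exact: exprn_ge0.
  move: t0; rewrite le_eqVlt => /predU1P[<-|t0].
    by rewrite powR0// gt_eqF// (lt_le_trans _ p1).
  by rewrite ge1r_powR// t0.
apply: ler_wpDl => //.
by rewrite -powR_mulrn// ler_powR.
Qed.

Lemma vanishing_Lnorm (F : family R T) (k : forall N, 'I_N.+2) (p : R) :
  vanishing_moments P F -> 1 <= p ->
  (fun N => 'N[P]_(p%:E)[(fun w => (F N (k N) w)%:E)]%E) @ \oo --> 0%E.
Proof.
move=> SF p1; have [mF SFr] := SF.
have p0 : 0 < p by rewrite (lt_le_trans _ p1).
pose r := (Num.truncn p).+1.
have pr : p <= r%:R by rewrite ltW// truncnS_gt.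
pose u N := 'N[P]_(p%:E)[(fun w => (F N (k N) w)%:E)]%E.
have small e : 0 < e -> exists N0, forall N, (N0 <= N)%N -> (u N <= e%:E)%E.
  move=> e0; have e'0 : 0 < e `^ p / 2 by rewrite divr_gt0// powR_gt0.
  have [N1 SF1] := SFr 1%N isT _ e'0.
  have [N2 SF2] := SFr r isT _ e'0.
  exists (maxn N1 N2) => N; rewrite geq_max => /andP[N1N N2N].
  have int_le : (\int[P]_w (`|F N (k N) w| `^ p)%:E <= (e `^ p)%:E)%E.
    apply: (@le_trans _ _ (\int[P]_w ((`|F N (k N) w| ^+ 1)%:E +
        (`|F N (k N) w| ^+ r)%:E))%E).
      apply: ge0_le_integral => //.
      - apply/measurable_EFinP.
        apply: (measurableT_comp (measurable_powR p)).
        exact: measurableT_comp.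
      - by apply: emeasurable_funD; exact: measurable_moment.
      - by move=> w _; rewrite -EFinD lee_fin expr1 powR_le_add_exp.
    rewrite ge0_integralD//; last 2 first.
    - exact: measurable_moment.
    - exact: measurable_moment.
    apply: (@le_trans _ _ ((e `^ p / 2)%:E + (e `^ p / 2)%:E)%E).
      by apply: leeD; [exact: SF1|exact: SF2].
    by rewrite -EFinD lee_fin -splitr.
  rewrite /u unlock.
  have -> : e%:E = (((e `^ p)%:E) `^ p^-1)%E.
    by rewrite poweR_EFin -powRrM mulfV ?gt_eqF// powRr1// ltW.
  apply: gt0_ler_poweR => //.
  - by rewrite invr_ge0 ltW.
  - by rewrite in_itv/= leey andbT integral_ge0.
  - by rewrite in_itv/= leey andbT lee_fin powR_ge0.
have u0 N : (0 <= u N)%E by exact: Lnorm_ge0.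
(* Convergence in the extended reals: the norms are eventually finite, and their real values tend to
   0. *)
apply/fine_cvgP; split.
  have [N0 uN0] := small 1 ltr01.
  exists N0 => // N N0N; rewrite /= ge0_fin_numE; last exact: u0.
  by apply: le_lt_trans (uN0 N N0N) _; exact: ltry.
apply/cvgr0Pnorm_le => e e0; have [N0 uN0] := small e e0.
exists N0 => // N N0N /=.
have uN : u N \is a fin_num.
  by rewrite ge0_fin_numE//; apply: le_lt_trans (uN0 N N0N) _; rewrite ltry.
rewrite ger0_norm; last by apply: fine_ge0; exact: u0.
by rewrite -lee_fin fineK// uN0.
Qed.

Lemma vanishing_enorm n (M : mx_family n 1) :
  mx_vanishing P M -> vanishing_moments P (fun N k w => enorm (M N k w)).
Proof.
move=> SM.
have S1 i : vanishing_moments P (fun N k w => `|M N k w i ord0|).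
  apply: (vanishing_moments_le (SM i ord0)) => [N k|N k w].
    by have [mM _] := SM i ord0; apply: measurableT_comp => //; exact: mM.
  by rewrite normr_id.
apply: (vanishing_moments_le (vanishing_moments_sum (index_enum 'I_n) S1)).
  move=> N k; apply: (measurableT_comp (continuous_measurable_fun (@sqrt_continuous R))).
  apply: measurable_sum => i; apply: measurable_funX.
  have [mM _] := SM i ord0; exact: mM.
move=> N k w; rewrite ger0_norm ?sqrtr_ge0// ger0_norm ?sumr_ge0//.
set S := \sum_(i <- _) _.
have S0 : 0 <= S by exact: sumr_ge0.
(* The Euclidean norm is at most the sum [S] of the absolute entries, since each squared entry is at
   most its absolute value times [S]. *)
rewrite -(ger0_norm S0) -sqrtr_sqr ler_wsqrtr// expr2 mulr_suml.
apply: ler_sum => i _; rewrite -real_normK ?num_real// expr2 ler_wpM2l//.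
by rewrite /S (bigD1 i)//= lerDl sumr_ge0.
Qed.

End Lp_convergence.
Theorem theorem59 (R : realType) (d : measure_display) (T : measurableType d)
    (P : probability T R) (n : nat) (q : nat -> nat)
    (A : nat -> 'M[R]_n) (b : nat -> 'cV[R]_n)
    (H : forall m : nat, 'M[R]_(q m, n)) (dat : forall m : nat, 'cV[R]_(q m))
    (V : forall m : nat, 'M[R]_(q m))
    (U0 : nat -> {RV P >-> 'cV[R]_n})
    (D : forall m : nat, nat -> {RV P >-> 'cV[R]_(q m)}) :
  (1 <= n)%N ->
  (forall m, (1 <= m)%N -> sym_posdef (V m)) ->
  iid U0 ->
  (forall k, gaussian (U0 k)) ->
  (forall m, (1 <= m)%N -> iid (D m)) ->
  (forall m k, (1 <= m)%N -> has_normal_law (D m k) (dat m) (V m)) ->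
  mutually_independent P
    (fun m : nat => if m is 0%N then sigma_seq U0 else sigma_seq (D m)) ->
  forall m : nat,
    (forall N : nat, (2 <= N)%N ->
      exchangeable P (fun (k : 'I_N) w =>
        col_mx (enkf A b H V U0 D N m k w) (reference P A b H V U0 D m k w))) /\
    (forall p : R, 1 <= p ->
      (fun N : nat => 'N[P]_(p%:E)[(fun w =>
         (enorm (enkf A b H V U0 D N.+2 m ord0 w
                 - reference P A b H V U0 D m 0%N w))%:E)]%E) @ \oo --> 0%E).
Proof.
move=> _ posdefV iidU0 gaussianU0 iidD lawD indUD m; split=> [N _|p p1].
  exact: exchangeable_enkf_reference.
exact: (vanishing_Lnorm (fun=> ord0) (vanishing_enorm
  (vanishing_enkf A b H posdefV iidU0 gaussianU0 iidD lawD indUD m)) p1).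
Qed.
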